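(* Let $X$ be a complete locally convex Hausdorff topological vector space over $\mathbb{C}$, let $\sigma$ be a continuous representation of $\mathbb{T}^n$ on $X$, and let $x\in X$. Then the Cesàro means of the square partial sums of the Fourier series of $x$ with respect to $\sigma$ converge to $x$ in the topology of $X$; that is, with $S_k^\sigma(x)=\sum_{\alpha\in\mathbb{Z}^n,\ |\alpha|_\infty\le k}\boldsymbol{\pi}^\sigma_\alpha(x)$, $$\lim_{N\to\infty}\frac{1}{N+1}\sum_{k=0}^{N}S_k^\sigma(x)=x\quad\text{in } X.$$
   Context: $\mathbb{T}^n=\{\lambda\in\mathbb{C}^n:|\lambda_j|=1,\ 1\le j\le n\}$ is the compact abelian group with componentwise multiplication, and $d\lambda$ is its Haar probability measure. A continuous representation $\sigma$ of $\mathbb{T}^n$ on $X$ is a group homomorphism $\lambda\mapsto\sigma_\lambda$ from $\mathbb{T}^n$ to the group of linear self-homeomorphisms of $X$ such that the map $\mathbb{T}^n\times X\to X$, $(\lambda,x)\mapsto\sigma_\lambda(x)$, is continuous. $X$ is complete if every Cauchy net converges. For $\alpha\in\mathbb{Z}^n$, $\lambda^\alpha=\lambda_1^{\alpha_1}\cdots\lambda_n^{\alpha_n}$ and $|\alpha|_\infty=\max_j|\alpha_j|$. The $\alpha$-th Fourier component of $x\in X$ is the Pettis (weak) integral $$\boldsymbol{\pi}^\sigma_\alpha(x)=\int_{\mathbb{T}^n}\lambda^{-\alpha}\sigma_\lambda(x)\,d\lambda,$$ i.e. the unique element of $X$ with $\phi(\boldsymbol{\pi}^\sigma_\alpha(x))=\int_{\mathbb{T}^n}\lambda^{-\alpha}\phi(\sigma_\lambda(x))\,d\lambda$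 for every continuous linear functional $\phi$ on $X$. The Fourier series of $x$ is the formal series $\sum_{\alpha\in\mathbb{Z}^n}\boldsymbol{\pi}^\sigma_\alpha(x)$. *)

(* Defs.v *)
From HB Require Import structures.
From mathcomp Require Import all_boot all_order all_algebra complex.
From mathcomp Require Import all_classical all_reals all_analysis.

Set Implicit Arguments.
Unset Strict Implicit.
Unset Printing Implicit Defensive.

Import Order.TTheory GRing.Theory Num.Theory numFieldNormedType.Exports.

Local Open Scope classical_set_scope.
Local Open Scope ring_scope.
Local Open Scope complex_scope.

(* The topology of the complex field [R[i]] is found on its copy [R[i]^o];
   it is the one given by the modulus. *)

Section Torus.
Variables (R : realType) (n : nat).

Record torus : Type := Torus {
  torus_val :> 'rV[R[i]^o]_n ;
  torus_valP : [forall j, `|torus_val 0 j| == 1] }.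

HB.instance Definition _ := [isSub for torus_val].
HB.instance Definition _ := [Choice of torus by <:].

Lemma torus_norm (l : torus) (j : 'I_n) : `|l 0 j| = 1.
Proof. by have /forallP/(_ j)/eqP := torus_valP l. Qed.

Fact torus_one_subproof : [forall j, `|(const_mx 1 : 'rV[R[i]^o]_n) 0 j| == 1].
Proof. by apply/forallP => j; rewrite mxE normr1. Qed.

Fact torus_inv_subproof (s : torus) :
  [forall j, `|(\row_k (s 0 k)^-1 : 'rV[R[i]^o]_n) 0 j| == 1].
Proof. by apply/forallP => j; rewrite mxE normfV torus_norm invr1. Qed.

Fact torus_mul_subproof (s t : torus) :
  [forall j, `|(\row_k (s 0 k * t 0 k) : 'rV[R[i]^o]_n) 0 j| == 1].
Proof. by apply/forallP => j; rewrite mxE normrM !torus_norm mulr1. Qed.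

Definition torus_one : torus := Torus torus_one_subproof.
Definition torus_inv (s : torus) : torus := Torus (torus_inv_subproof s).
Definition torus_mul (s t : torus) : torus := Torus (torus_mul_subproof s t).

Let torus_neq0 (l : torus) (j : 'I_n) : l 0 j != 0.
Proof. by rewrite -normr_gt0 torus_norm ltr01. Qed.

Fact torus_mulA : associative torus_mul.
Proof. by move=> s t u; apply/val_inj/rowP => j; rewrite !mxE mulrA. Qed.

Fact torus_mulC : commutative torus_mul.
Proof. by move=> s t; apply/val_inj/rowP => j; rewrite !mxE mulrC. Qed.

Fact torus_mul1 : left_id torus_one torus_mul.
Proof. by move=> s; apply/val_inj/rowP => j; rewrite !mxE mul1r. Qed.

Fact torus_mulV : left_inverse torus_one torus_inv torus_mul.
Proof. by move=> s; apply/val_inj/rowP => j; rewrite !mxE mulVf. Qed.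

Fact torus_mulr1 : right_id torus_one torus_mul.
Proof. by move=> s; rewrite torus_mulC torus_mul1. Qed.

Fact torus_mulrV : right_inverse torus_one torus_inv torus_mul.
Proof. by move=> s; rewrite torus_mulC torus_mulV. Qed.

HB.instance Definition _ := isGroup.Build torus
  torus_mulA torus_mul1 torus_mulr1 torus_mulV torus_mulrV.

HB.instance Definition _ := isPointed.Build torus torus_one.
HB.instance Definition _ :=
  Topological.copy torus (initial_topology torus_val).
HB.instance Definition _ :=
  Measurable.copy torus (g_sigma_algebraType (@open torus)).

(* Invariance characterizes the Haar probability measure among the Borel
   probability measures on this compact metrizable group. *)
Definition haar (mu : probability torus R) : Prop :=
  forall (s : torus) (A : set torus), measurable A ->
    mu [set (s * t)%g | t in A] = mu A.

Definition torus_char (a : {ffun 'I_n -> int}) (l : torus) : R[i] :=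
  \prod_(j < n) (l 0 j : R[i]) ^ a j.

Definition sup_norm (a : {ffun 'I_n -> int}) : nat := \max_(j < n) `|a j|%N.

End Torus.

Section Complete.
Variables (K : numDomainType) (X : tvsType K).

Definition directed (I : Type) (le : I -> I -> Prop) : Prop :=
  [/\ inhabited I, (forall i, le i i),
      (forall i j k, le i j -> le j k -> le i k) &
      (forall i j, exists k, le i k /\ le j k)].

Definition net_cvg (I : Type) (le : I -> I -> Prop) (u : I -> X) (x : X) :=
  forall U : set X, nbhs x U -> exists i0, forall i, le i0 i -> U (u i).

Definition cauchy_net (I : Type) (le : I -> I -> Prop) (u : I -> X) :=
  forall U : set X, nbhs 0 U ->
    exists i0, forall i j, le i0 i -> le i0 j -> U (u i - u j).

(* The library's [cauchy] refers to the entourages of [X], which in a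
   [tvsType] induce the topology but need not be translation invariant, so it
   can differ from the notion attached to the topological vector space. *)
Definition complete_tvs : Prop :=
  forall (I : Type) (le : I -> I -> Prop) (u : I -> X),
    directed le -> cauchy_net le u -> exists x, net_cvg le u x.

Definition linear_self_homeomorphism (f : X -> X) : Prop :=
  [/\ linear f, continuous f &
      exists g : X -> X, [/\ cancel f g, cancel g f & continuous g]].

End Complete.

Section Fourier.
Variables (R : realType) (n : nat) (X : tvsType R[i]).

Definition continuous_representation (sigma : torus R n -> X -> X) : Prop :=
  [/\ (forall l, linear_self_homeomorphism (sigma l)),
      (forall s t, sigma (s * t)%g = sigma s \o sigma t) &
      continuous (fun p : torus R n * X => sigma p.1 p.2)].

Variable mu : probability (torus R n) R.

Definition cintegral (f : torus R n -> R[i]) : R[i] :=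
  (\int[mu]_l complex.Re (f l)) +i* (\int[mu]_l complex.Im (f l)).

Definition is_pettis_integral (F : torus R n -> X) (y : X) : Prop :=
  forall phi : {linear X -> R[i]^o}, continuous phi ->
    phi y = cintegral (fun l => phi (F l)).

(* The junk value 0 is used only when no element satisfies the defining
   property; by Hahn-Banach at most one does when [X] is Hausdorff. *)
Definition pettis_integral (F : torus R n -> X) : X :=
  xget 0 (is_pettis_integral F).

Variable sigma : torus R n -> X -> X.

Definition fourier_component (a : {ffun 'I_n -> int}) (x : X) : X :=
  pettis_integral (fun l => torus_char (- a) l *: sigma l x).

(* The index set is finite, so this is the ordinary finite sum. *)
Definition square_partial_sum (k : nat) (x : X) : X :=
  \sum_(a \in [set a : {ffun 'I_n -> int} | (sup_norm a <= k)%N])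
    fourier_component a x.

Definition cesaro_mean (N : nat) (x : X) : X :=
  N.+1%:R^-1 *: \sum_(0 <= k < N.+1) square_partial_sum k x.

End Fourier.

(* Main.v *)
Require Import Defs.
From HB Require Import structures.
From mathcomp Require Import all_boot all_order all_algebra complex.
From mathcomp Require Import all_classical all_reals all_analysis measurable_realfun.
From mathcomp Require Import ring lra zify.

(** Write D_k(z) for the sum of the z^m with -k <= m <= k, and
    K_N(l) = (N+1)^-1 * sum_(k <= N) prod_j D_k(l_j)   ([cesaro_kernel]).
    Every continuous functional phi sends the N-th Cesaro mean of x to the
    integral of K_N(l) * phi (sigma_l x), and K_N has integral 1; hence
      phi (mean - x) = integral of K_N(l) * phi (sigma_l x - x).
    If p is a continuous seminorm dominating the real part of phi, the real
    part of the right-hand side is at most the integral of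
    |K_N(l)| * p (sigma_l x - x), a bound in which phi no longer occurs.  By
    Hahn-Banach ([norming_functional]) it bounds p (mean - x) itself.  Since
    l |-> p (sigma_l x - x) is continuous on a compact group and vanishes at
    the identity, it remains to see that K_N is bounded in L^1
    ([kernel_L1_bounded]) and that |K_N| concentrates at the identity
    ([kernel_concentrates]).

    For n = 1 the kernel K_N is the Fejer kernel, which is positive, and both
    facts are classical.  For n >= 2 it is the Marcinkiewicz kernel: it changes
    sign and is not a product, so an argument is required.  It is a weighted
    Cauchy-Schwarz inequality.  Put b = 2^(n+2) and let M = b^L be the power of
    b just above N.  Two positive functions of one unit complex number are
    built from Fejer kernels F_m at the scales m = b^i, i <= L:
      q = sum_i 2^-(L-i) F_(b^i)                      ([fejer_majorant]),
      w = 1/M + |1-z|^2 * sum_i 2^(L-i) F_(b^i)       ([dual_weight]).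
    Up to constants q is M * min (1, (M|1-z|)^(-1-d)) with b^d = 2, and w is
    its inverse, so that w * q is bounded below ([majorant_dual_weight]).  Let
    W and Q be the products of the w(l_j) and of the q(l_j).  Then
    |K_N| <= const * (|K_N|^2 W + Q) by the inequality between arithmetic and
    geometric means.  The integral of Q is the n-th power of the constant term
    of q, thus at most 2^n.  The integral of |K_N|^2 W is the average over
    k, l <= N of the n-th powers of the integrals of D_k D_l w.  In
    |1-z|^2 D_k D_l all but four monomials cancel ([norm1B_dirichletM]), which
    makes the integral of D_k D_l w at most of order (M/|k-l|)^d ([gram_le]).
    Because n * d < 1, the n-th powers of these numbers have a bounded average
    ([near_diagonal_sum]).

    Concentration comes from the same inequality with a parameter,
      2 |K_N| h <= s * const * |K_N|^2 W + s^-1 h^2 Q,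
    where h vanishes at the identity only: the integral of h^2 Q tends to 0
    since Q does concentrate, and s is arbitrary.

    The kernels and weights above are combinations of products over j of finite
    Laurent sums in l_j, so invariance of the measure enters through the
    orthogonality of characters alone ([cintegral_laurent_prod]).

    The Fourier components are defined by a weak integral, which must be shown
    to exist.  Completeness gives it as the limit of Riemann sums indexed by
    the neighbourhoods of 0 ([is_pettis_integral_exists]). *)

Set Implicit Arguments.
Unset Strict Implicit.
Unset Printing Implicit Defensive.
Import Order.TTheory GRing.Theory Num.Theory numFieldNormedType.Exports.
Local Open Scope classical_set_scope.
Local Open Scope ring_scope.

(** * Counting pairs near the diagonal, scale by scale *)

Section Counting.
Local Open Scope nat_scope.

(** Only the scales with d < b^i contribute, and their weights decrease
    geometrically: the sum is at most twice its first nonzero term, whose n-th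
    power is one of the terms on the right. *)
Lemma dyadic_sum_expn (n b L d : nat) : 0 < b -> d < b ^ L ->
  (\sum_(i < L.+1) 2 ^ (L - i) * (d < b ^ i)) ^ n <=
  2 ^ n * \sum_(i < L.+1) 2 ^ (n * (L - i)) * (d < b ^ i).
Proof.
move=> b0 dL.
have [i0 [i0L di0 Si0]] : exists i0, [/\ i0 <= L, d < b ^ i0 &
    (\sum_(i < L.+1) 2 ^ (L - i) * (d < b ^ i)).+1 <= 2 * 2 ^ (L - i0)].
  elim: L dL => [|L IH] dL.
    exists 0; split => //.
    by rewrite big_ord_recl big_ord0 expn0 addn0 mul1n; case: (d < _).
  rewrite big_ord_recr /= subnn expn0 mul1n dL.
  have -> : \sum_(i < L.+1) 2 ^ (L.+1 - i) * (d < b ^ i) =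
      2 * \sum_(i < L.+1) 2 ^ (L - i) * (d < b ^ i).
    rewrite big_distrr /=; apply: eq_bigr => i _.
    by rewrite subSn -1?ltnS// expnS mulnA.
  have [dbL|dbL] := ltnP d (b ^ L).
    have [i0 [i0L di0 Si0]] := IH dbL.
    exists i0; split => //; first exact: leqW.
    rewrite subSn// expnS; lia.
  exists L.+1; split => //; rewrite subnn expn0 big1 // => i _.
  have bi : b ^ i <= b ^ L by rewrite leq_pexp2l// -ltnS.
  by rewrite ltnNge (leq_trans bi dbL) muln0.
have i0S : i0 < L.+1 by [].
apply: (@leq_trans ((2 * 2 ^ (L - i0)) ^ n)).
  by case: n => // n; rewrite leq_exp2r// ltnW.
rewrite expnMn leq_mul2l; apply/orP; right.
rewrite (bigD1 (Ordinal i0S)) //= di0 muln1 -expnM mulnC; exact: leq_addr.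
Qed.

Lemma card_near_le (N k m : nat) : \sum_(l < N) (`|k%:Z - l%:Z| < m) <= 2 * m.
Proof.
have -> : \sum_(l < N) (`|k%:Z - l%:Z| < m) =
    #|[pred l : 'I_N | `|k%:Z - l%:Z| < m]|.
  by rewrite -sum1_card [RHS]big_mkcond; apply: eq_bigr => i _; rewrite inE; case: ifP.
case: m => [|m].
  by rewrite eq_card0 // => l; rewrite !inE ltn0.
(* Translation moves the band around k to an initial segment. *)
pose g (l : 'I_N) : 'I_(2 * m).+2 := inord (l + m.+1 - k).
have -> : 2 * m.+1 = (2 * m).+2 by lia.
rewrite -[X in _ <= X]card_ord -(@card_in_imset _ _ g) ?max_card//.
have gE (l : 'I_N) : `|k%:Z - l%:Z| < m.+1 -> g l = l + m.+1 - k :> nat.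
  by move=> lk; rewrite /g inordK //; lia.
move=> l l'; rewrite !inE => ll ll' /(congr1 val) /=.
rewrite !gE// => e; apply: val_inj => /=; lia.
Qed.

(** Since b is at least twice 2^n, passing to the next scale at least doubles
    the terms, so the last one dominates. *)
Lemma geometric_weight_sum (n b L : nat) : 2 ^ n.+1 <= b ->
  \sum_(i < L.+1) 2 ^ (n * (L - i)) * b ^ i <= 2 * b ^ L.
Proof.
move=> nb; elim: L => [|L IH].
  by rewrite big_ord_recl big_ord0 subnn muln0.
rewrite big_ord_recr /= subnn muln0 mul1n.
have -> : \sum_(i < L.+1) 2 ^ (n * (L.+1 - i)) * b ^ i =
    2 ^ n * \sum_(i < L.+1) 2 ^ (n * (L - i)) * b ^ i.
  rewrite big_distrr /=; apply: eq_bigr => i _.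
  by rewrite subSn -1?ltnS// mulnS expnD mulnA.
rewrite mul2n -addnn leq_add2r expnS.
apply: (@leq_trans (2 ^ n * (2 * b ^ L))); first by rewrite leq_mul2l IH orbT.
by rewrite mulnA -expnSr leq_mul2r nb orbT.
Qed.

(** Average size of the n-th powers of the numbers bounding the integrals of
    D_k D_l w.  They are of order 2^(L-i) on the band |k-l| < b^i: from one
    scale to the previous one the n-th power grows by 2^n whereas the number of
    pairs is divided by b, and b > 2^n makes the widest band dominate. *)
Lemma near_diagonal_sum (n b L N : nat) : 2 ^ n.+1 <= b -> N <= b ^ L ->
  \sum_(k < N) \sum_(l < N)
     (4 * \sum_(i < L.+1) 2 ^ (L - i) * (`|k%:Z - l%:Z| < b ^ i)) ^ n <=
  4 * 8 ^ n * N * b ^ L.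
Proof.
move=> nb Nb.
have b0 : 0 < b by apply: leq_trans nb; rewrite expn_gt0.
apply: (@leq_trans (\sum_(k < N) \sum_(l < N)
    8 ^ n * \sum_(i < L.+1) 2 ^ (n * (L - i)) * (`|k%:Z - l%:Z| < b ^ i))).
  apply: leq_sum => k _; apply: leq_sum => l _.
  rewrite expnMn (_ : 8 = 4 * 2)// [(4 * 2) ^ n]expnMn -mulnA.
  rewrite leq_mul2l dyadic_sum_expn ?orbT//.
  by apply: leq_trans Nb; have := ltn_ord k; have := ltn_ord l; lia.
under eq_bigr do rewrite -big_distrr /=.
rewrite -big_distrr /= [4 * _]mulnC -!mulnA leq_mul2l; apply/orP; right.
under eq_bigr do rewrite exchange_big /=.
rewrite exchange_big /=.
apply: (@leq_trans (\sum_(i < L.+1) N * 2 * (2 ^ (n * (L - i)) * b ^ i))).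
  apply: leq_sum => i _; under eq_bigr do rewrite -big_distrr /=.
  rewrite -big_distrr /= mulnCA leq_mul2l; apply/orP; right.
  apply: (@leq_trans (\sum_(k < N) 2 * b ^ i)).
    by apply: leq_sum => k _; exact: card_near_le.
  by rewrite sum_nat_const card_ord mulnA.
rewrite -big_distrr /=.
apply: (@leq_trans (N * 2 * (2 * b ^ L))).
  by rewrite leq_mul2l geometric_weight_sum ?orbT.
by rewrite (_ : 4 = 2 * 2)//; lia.
Qed.

End Counting.

(** * Fejer kernels and two dual weights on the unit circle *)

Section UnitCircle.
Variable C : numClosedFieldType.
Implicit Types (z a c d : C) (f g : C -> C) (L k l m b : nat).

Lemma unit_neq0 z : `|z| = 1 -> z != 0.
Proof. by move=> z1; rewrite -normr_gt0 z1 ltr01. Qed.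

Lemma unit_conj z : `|z| = 1 -> z^* = z^-1.
Proof. by move=> z1; rewrite invC_norm z1 expr1n invr1 mul1r. Qed.

Lemma unit_conjz z (e : int) : `|z| = 1 -> (z ^ e)^* = z ^ (- e).
Proof. by move=> z1; rewrite rmorphXz ?unitfE ?unit_neq0//= unit_conj// exprz_inv. Qed.

Lemma norm_1BX z m : `|z| = 1 -> `|1 - z ^+ m| <= m%:R * `|1 - z|.
Proof.
move=> z1; elim: m => [|m IH]; first by rewrite subrr normr0 mul0r.
rewrite (_ : 1 - z ^+ m.+1 = (1 - z) + z * (1 - z ^+ m)); last first.
  by rewrite exprS mulrBr mulr1 addrA subrK.
rewrite (le_trans (ler_normD _ _))// normrM z1 mul1r -natr1 mulrDl mul1r addrC.
by rewrite lerD2r.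
Qed.

Definition fejer m z : C := m%:R^-1 * `|\sum_(i < m) z ^+ i| ^+ 2.

Lemma fejer_ge0 m z : 0 <= fejer m z.
Proof. by rewrite mulr_ge0 ?invr_ge0 ?exprn_ge0. Qed.

Lemma fejer1 z : fejer 1 z = 1.
Proof. by rewrite /fejer big_ord1 expr0 normr1 invr1 mul1r expr1n. Qed.

(** Each of the m powers of z is within 1/2 of 1, so that their sum has modulus
    at least m/2. *)
Lemma fejer_near1 m z : `|z| = 1 -> (0 < m)%N -> (2 * m)%:R * `|1 - z| <= 1 ->
  m%:R / 4 <= fejer m z.
Proof.
move=> z1 m0 hz.
have mC : 0 < m%:R :> C by rewrite ltr0n.
have S2 : m%:R / 2 <= `|\sum_(i < m) z ^+ i|.
  have : `|\sum_(i < m) (1 - z ^+ i)| <= m%:R / 2.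
    apply: le_trans (ler_norm_sum _ _ _) _.
    apply: (@le_trans _ _ (\sum_(i < m) 2^-1)); last first.
      by rewrite sumr_const card_ord mulr_natl.
    apply: ler_sum => i _; apply: le_trans (norm_1BX _ z1) _.
    rewrite -(ler_pM2l (ltr0Sn C 1)) mulrA mulfV ?pnatr_eq0//.
    apply: le_trans hz; rewrite natrM ler_wpM2r// ler_wpM2l// ler_nat ltnW//.
  rewrite sumrB sumr_const card_ord => h.
  have := lerB_dist (m%:R : C) (m%:R - \sum_(i < m) z ^+ i).
  rewrite subKr normr_nat => /(le_trans _); apply.
  by rewrite lerBrDr -lerBrDl (le_trans h)// [X in _ <= X - _](splitr m%:R) addrK.
rewrite /fejer ler_pdivlMl//.
have m20 : 0 <= m%:R / 2 :> C by rewrite divr_ge0 ?ltW.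
apply: le_trans (lerXn2r 2 m20 (normr_ge0 _) S2).
by rewrite expr_div_n mulrA -expr2 (_ : 4 = 2 ^+ 2 :> C)// -natrX.
Qed.

Variable b : nat.
Hypothesis b_gt0 : (0 < b)%N.

(** A multiscale replacement for M * min (1, (M|1-z|)^(-1-d)), where M = b^L
    and b^d = 2.  It is assembled from Fejer kernels because their Fourier
    coefficients are explicit, and at the scales b^i because the exponent d
    then only shows through integer powers of 2. *)
Definition fejer_majorant L z : C :=
  \sum_(i < L.+1) (2 ^ (L - i))%:R^-1 * fejer (b ^ i) z.

(** Up to constants, the inverse of [fejer_majorant].  It is written with a factor
    |1-z|^2 because this factor makes Dirichlet kernels telescope. *)
Definition dual_weight L z : C :=
  (b ^ L)%:R^-1 +
  `|1 - z| ^+ 2 * \sum_(i < L.+1) (2 ^ (L - i))%:R * fejer (b ^ i) z.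

Lemma fejer_majorant_ge0 L z : 0 <= fejer_majorant L z.
Proof. by apply: sumr_ge0 => i _; rewrite mulr_ge0 ?invr_ge0 ?fejer_ge0. Qed.

Lemma dual_weight_ge0 L z : 0 <= dual_weight L z.
Proof.
rewrite addr_ge0 ?invr_ge0// mulr_ge0 ?exprn_ge0//.
by apply: sumr_ge0 => i _; rewrite mulr_ge0 ?fejer_ge0.
Qed.

Lemma term_le_sum m (F : 'I_m -> C) (i : 'I_m) : (forall j, 0 <= F j) ->
  F i <= \sum_(j < m) F j.
Proof. by move=> F0; rewrite (bigD1 i)//= lerDl sumr_ge0. Qed.

(** Take for b^i the largest scale that is small compared with the inverse of
    |1-z|, so that F_(b^i) has its maximal order at z, or else the scale 1,
    where the Fejer kernel is constant. *)
Lemma critical_scale L z : `|z| = 1 -> exists i : 'I_L.+1,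
  (b ^ i)%:R / 4 <= fejer (b ^ i) z /\
  (i = L :> nat \/ 1 <= (2 * b ^ i.+1)%:R * `|1 - z|).
Proof.
move=> z1; elim: L => [|L [i [iF iz]]].
  exists ord0; split; last by left.
  by rewrite expn0 fejer1 ler_pdivrMr ?ltr0n// mul1r ler1n.
have [h|] := boolP ((2 * b ^ L.+1)%:R * `|1 - z| <= 1).
  exists ord_max; split; last by left.
  by apply: fejer_near1; rewrite ?expn_gt0 ?b_gt0.
rewrite -real_ltNge ?realM ?realn// => h.
exists (widen_ord (leqnSn _) i); split => //; right.
by case: iz => [iL|//]; rewrite /= iL ltW.
Qed.

(** At the critical scale i both sums contain the term with F_(b^i), which is at
    least b^i/4; the two geometric weights are inverse to one another, and
    |1-z|^2 compensates for the remaining b^(2i).  At the last scale the term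
    1/b^L of the dual weight plays this part. *)
Lemma majorant_dual_weight L z : `|z| = 1 ->
  1 <= (64 * b ^ 2)%:R * (dual_weight L z * fejer_majorant L z).
Proof.
move=> z1; have [i [iF iz]] := critical_scale L z1.
have bC k : 0 < (b ^ k)%:R :> C by rewrite ltr0n expn_gt0 b_gt0.
have p2 k : 0 < (2 ^ k)%:R :> C by rewrite ltr0n expn_gt0.
have q_ge : (2 ^ (L - i))%:R^-1 * ((b ^ i)%:R / 4) <= fejer_majorant L z.
  apply: le_trans (term_le_sum i _) => [|j]; last first.
    by rewrite mulr_ge0 ?invr_ge0 ?fejer_ge0.
  by rewrite ler_wpM2l// invr_ge0.
have q0 : 0 <= (2 ^ (L - i))%:R^-1 * ((b ^ i)%:R / 4) :> C.
  by rewrite mulr_ge0 ?invr_ge0// divr_ge0.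
case: iz => [iL|iz].
  have w_ge : (b ^ L)%:R^-1 <= dual_weight L z.
    rewrite /dual_weight lerDl mulr_ge0 ?exprn_ge0//.
    by apply: sumr_ge0 => j _; rewrite mulr_ge0 ?fejer_ge0.
  apply: (@le_trans _ _ ((64 * b ^ 2)%:R *
      ((b ^ L)%:R^-1 * ((2 ^ (L - i))%:R^-1 * ((b ^ i)%:R / 4))))).
    rewrite iL subnn expn0 invr1 mul1r.
    have -> : (64 * b ^ 2)%:R * ((b ^ L)%:R^-1 * ((b ^ L)%:R / 4)) =
        (16 * b ^ 2)%:R :> C.
      by rewrite !natrM; field; rewrite gt_eqF.
    by rewrite ler1n muln_gt0 expn_gt0 b_gt0.
  rewrite ler_wpM2l// ler_pM// invr_ge0//.
have w_ge : `|1 - z| ^+ 2 * ((2 ^ (L - i))%:R * ((b ^ i)%:R / 4)) <=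
    dual_weight L z.
  rewrite /dual_weight ler_wpDl ?invr_ge0// ler_wpM2l ?exprn_ge0//.
  apply: le_trans (term_le_sum i _) => [|j]; last first.
    by rewrite mulr_ge0 ?fejer_ge0.
  by rewrite ler_wpM2l.
apply: (@le_trans _ _ ((64 * b ^ 2)%:R *
   ((`|1 - z| ^+ 2 * ((2 ^ (L - i))%:R * ((b ^ i)%:R / 4))) *
      ((2 ^ (L - i))%:R^-1 * ((b ^ i)%:R / 4))))); last first.
  rewrite ler_wpM2l// ler_pM//.
have -> : (64 * b ^ 2)%:R *
   ((`|1 - z| ^+ 2 * ((2 ^ (L - i))%:R * ((b ^ i)%:R / 4))) *
      ((2 ^ (L - i))%:R^-1 * ((b ^ i)%:R / 4))) =
   ((2 * b ^ i.+1)%:R * `|1 - z|) ^+ 2 :> C.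
  rewrite (expnS b i) !natrM; have := lt0r_neq0 (p2 (L - i)%N).
  by move: (2 ^ (L - i))%:R (b ^ i)%:R => T B T0; field.
by rewrite exprn_ege1.
Qed.

End UnitCircle.

(** * Constant terms of Laurent sums *)

Section Laurent.
Variable C : numClosedFieldType.
Implicit Types (z a c d : C) (f g : C -> C) (L k l m b : nat).

(** Only the values on the unit circle are constrained, because the functions of
    interest contain squared moduli, which are Laurent sums only there.  The
    number c is the constant term, that is, the mean of f over the circle. *)
Definition laurent f c : Prop :=
  exists m (a : 'I_m -> C) (e : 'I_m -> int),
    (forall z, `|z| = 1 -> f z = \sum_i a i * z ^ e i) /\
    c = \sum_i a i * (e i == 0)%:R.

Lemma laurent_ext f g c d : laurent f c ->
  (forall z, `|z| = 1 -> f z = g z) -> c = d -> laurent g d.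
Proof.
by move=> [m [a [e [fE ->]]]] fg <-; exists m, a, e; split=> // z z1; rewrite -fg// fE.
Qed.

Lemma laurent_monomial a (e : int) : laurent (fun z => a * z ^ e) (a * (e == 0)%:R).
Proof. by exists 1%N, (fun=> a), (fun=> e); split=> [z _|]; rewrite big_ord1. Qed.

Lemma laurent0 : laurent (fun=> 0) 0.
Proof. by exists 0%N, (fun=> 0), (fun=> 0); split=> [z _|]; rewrite big_ord0. Qed.

Lemma laurentD f g c d : laurent f c -> laurent g d ->
  laurent (fun z => f z + g z) (c + d).
Proof.
move=> [m [a [e [fE ->]]]] [m' [a' [e' [gE ->]]]].
exists (m + m')%N,
  (fun i : 'I_(m + m') =>
     match fintype.split i with inl j => a j | inr j => a' j end),
  (fun i : 'I_(m + m') =>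
     match fintype.split i with inl j => e j | inr j => e' j end).
have sl j : fintype.split (lshift m' j) = inl j :> 'I_m + 'I_m' by exact: (unsplitK (inl j)).
have sr j : fintype.split (rshift m j) = inr j :> 'I_m + 'I_m' by exact: (unsplitK (inr j)).
split=> [z z1|]; rewrite big_split_ord/= ?fE ?gE//; congr (_ + _);
  by apply: eq_bigr => j _; rewrite ?sl ?sr.
Qed.

Lemma laurentZ a f c : laurent f c -> laurent (fun z => a * f z) (a * c).
Proof.
move=> [m [a' [e [fE ->]]]]; exists m, (fun i => a * a' i), e.
split=> [z z1|]; rewrite ?fE// mulr_sumr; apply: eq_bigr => i _; exact: mulrA.
Qed.

Lemma laurent_sum (I : finType) (f : I -> C -> C) (c : I -> C) :
  (forall i, laurent (f i) (c i)) ->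
  laurent (fun z => \sum_i f i z) (\sum_i c i).
Proof.
move=> fc; elim: (index_enum I) => [|i r IH].
  by apply: laurent_ext laurent0 _ _ => [z _|]; rewrite big_nil.
by apply: laurent_ext (laurentD (fc i) IH) _ _ => [z _|]; rewrite big_cons.
Qed.

Lemma indicator_le1 m (e : int) : \sum_(i < m) (i%:Z == e)%:R <= 1 :> C.
Proof.
have [[i ie]|no] := pselect (exists i : 'I_m, i%:Z = e).
  rewrite (bigD1 i)//= ie eqxx big1 ?addr0// => j ji.
  case: eqP => // je; case/eqP: ji; apply: val_inj => /=; lia.
by rewrite big1// => i _; case: eqP => // ie; case: no; exists i.
Qed.

(** The classical coefficient max (0, 1 - |e|/m), as the normalised number of
    pairs of exponents below m with difference e. *)
Definition fejer_coef m (e : int) : C :=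
  m%:R^-1 * \sum_(r < m) \sum_(p < m) (p%:Z == r%:Z - e)%:R.

Lemma fejer_coef_itv m e : 0 <= fejer_coef m e <= 1.
Proof.
case: m => [|m]; first by rewrite /fejer_coef big_ord0 mulr0 lexx ler01.
rewrite mulr_ge0 ?invr_ge0//=; last by do 2!apply: sumr_ge0 => ? _.
rewrite ler_pdivrMl ?ltr0n// mulr1.
apply: (@le_trans _ _ (\sum_(r < m.+1) 1)); last by rewrite sumr_const card_ord.
by apply: ler_sum => r _; exact: indicator_le1.
Qed.

Lemma fejer_coef_out m (e : int) : (m <= `|e|)%N -> fejer_coef m e = 0.
Proof.
move=> me; rewrite /fejer_coef big1 ?mulr0// => r _; rewrite big1// => p _.
by case: eqP => //; have := ltn_ord r; have := ltn_ord p; lia.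
Qed.

Lemma laurent_fejer m (e : int) :
  laurent (fun z => fejer m z * z ^ e) (fejer_coef m e).
Proof.
apply: laurent_ext (laurentZ m%:R^-1 (laurent_sum (fun r : 'I_m =>
  laurent_sum (fun p : 'I_m => laurent_monomial 1 (p%:Z - r%:Z + e))))) _ _.
  move=> z z1 /=; rewrite /fejer -mulrA; congr (_ * _).
  rewrite normCK rmorph_sum -mulrA mulr_suml exchange_big /=.
  apply: eq_bigr => p _; rewrite mulr_suml mulr_sumr; apply: eq_bigr => r _.
  rewrite mul1r !exprnP unit_conjz// !expfzDr ?unit_neq0// mulrA//.
congr (_ * _); apply: eq_bigr => r _; apply: eq_bigr => p _; rewrite mul1r.
by congr (nat_of_bool _)%:R; apply/eqP/eqP => ?; lia.
Qed.

(** The factor 1-z telescopes the geometric sum in the Fejer kernel, leaving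
    |1-z^m|^2 / m. *)
Lemma laurent_fejer_moment m : (0 < m)%N ->
  laurent (fun z => `|1 - z| ^+ 2 * fejer m z) (2 / m%:R).
Proof.
move=> m0.
apply: laurent_ext (laurentZ m%:R^-1 (laurentD (laurent_monomial 2 0)
  (laurentD (laurent_monomial (-1) m%:Z) (laurent_monomial (-1) (- m%:Z))))) _ _.
  move=> z z1; rewrite /fejer mulrCA -exprMn -normrM.
  have -> : (1 - z) * (\sum_(i < m) z ^+ i) = 1 - z ^+ m.
    rewrite -[1 in RHS](expr1n _ m) subrXX; congr (_ * _).
    by apply: eq_bigr => i _; rewrite expr1n mul1r.
  rewrite normCK rmorphB rmorph1 /= (exprnP z m) unit_conjz//; congr (_ * _).
  have := expfzDr m (- m%:Z) (unit_neq0 z1); rewrite subrr expr0z => zz.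
  by rewrite mulrBl !mulrBr -zz; ring.
rewrite eqxx mulr1 oppr_eq0 (_ : (m%:Z == 0) = false) ?mulr0 ?addr0 1?mulrC//.
by apply/negbTE; rewrite -lt0n.
Qed.

Definition dirichlet k z : C := \sum_(i < (2 * k).+1) z ^ (i%:Z - k%:Z).

Lemma dirichlet_real k z : `|z| = 1 -> (dirichlet k z)^* = dirichlet k z.
Proof.
move=> z1; rewrite rmorph_sum /= /dirichlet (reindex_inj rev_ord_inj) /=.
apply: eq_bigr => i _; rewrite unit_conjz//; congr (_ ^ _).
have := ltn_ord i; lia.
Qed.

Lemma telescope_dirichlet k z : `|z| = 1 ->
  (1 - z) * dirichlet k z = z ^ (- k%:Z) - z ^ (k%:Z + 1).
Proof.
move=> z1; have z0 := unit_neq0 z1.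
have -> : dirichlet k z = z ^ (- k%:Z) * \sum_(i < (2 * k).+1) z ^+ i.
  rewrite mulr_sumr; apply: eq_bigr => i _.
  by rewrite exprnP -expfzDr// addrC.
rewrite mulrCA.
have -> : (1 - z) * (\sum_(i < (2 * k).+1) z ^+ i) = 1 - z ^+ (2 * k).+1.
  rewrite -[1 in RHS](expr1n _ (2 * k).+1) subrXX; congr (_ * _).
  by apply: eq_bigr => i _; rewrite expr1n mul1r.
rewrite mulrBr mulr1 exprnP -expfzDr//; congr (_ - z ^ _); lia.
Qed.

(** Both Dirichlet kernels telescope; the second one is real on the circle, so
    it may absorb the conjugate of 1-z. *)
Lemma norm1B_dirichletM k l z : `|z| = 1 ->
  `|1 - z| ^+ 2 * (dirichlet k z * dirichlet l z) =
  z ^ (l%:Z - k%:Z) - z ^ (- k%:Z - l%:Z - 1) - z ^ (k%:Z + l%:Z + 1)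
   + z ^ (k%:Z - l%:Z).
Proof.
move=> z1; have z0 := unit_neq0 z1.
rewrite normCK -[dirichlet l z]dirichlet_real// mulrACA -rmorphM/=.
rewrite !telescope_dirichlet// rmorphB/= !unit_conjz//.
rewrite mulrBl !mulrBr -!expfzDr// opprB addrA.
have -> : - k%:Z - - l%:Z = l%:Z - k%:Z by lia.
have -> : - k%:Z - (l%:Z + 1) = - k%:Z - l%:Z - 1 by lia.
have -> : k%:Z + 1 - - l%:Z = k%:Z + l%:Z + 1 by lia.
have -> : k%:Z + 1 - (l%:Z + 1) = k%:Z - l%:Z by lia.
ring.
Qed.

(** The constant term of |1-z|^2 D_k D_l F_m. *)
Definition gram_term m k l : C :=
  fejer_coef m (l%:Z - k%:Z) - fejer_coef m (- k%:Z - l%:Z - 1)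
  - fejer_coef m (k%:Z + l%:Z + 1) + fejer_coef m (k%:Z - l%:Z).

(** Away from the band |k-l| < m the four Fejer coefficients vanish; inside it
    they occur in two differences of numbers of [0, 1]. *)
Lemma gram_term_le m k l :
  `|gram_term m k l| <= 2 * (`|k%:Z - l%:Z| < m)%N%:R.
Proof.
rewrite /gram_term; have [near|far] := ltnP; last first.
  by rewrite !fejer_coef_out ?subrr ?addr0 ?normr0 ?mulr0//; lia.
rewrite mulr1 addrAC -addrA.
have d u v : `|fejer_coef m u - fejer_coef m v| <= 1.
  have /andP[u0 u1] := fejer_coef_itv m u.
  have /andP[v0 v1] := fejer_coef_itv m v.
  rewrite real_ler_norml ?realB ?ger0_real// lerBrDr addrC -lerBrDr opprK.
  rewrite (le_trans v1) ?lerDr//= lerBlDr (le_trans u1)// lerDl//.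
apply: le_trans (_ : 1 + 1 <= _) => //.
apply: le_trans (ler_normD _ _) _; exact: lerD.
Qed.

Variable b : nat.
Hypothesis b_gt0 : (0 < b)%N.

(** The constant term of D_k D_l. *)
Definition dirichlet_corr k l : C :=
  \sum_(i < (2 * k).+1) \sum_(j < (2 * l).+1)
    (j%:Z == k%:Z + l%:Z - i%:Z)%:R.

(** The constant term of D_k D_l w, hence an entry of the Gram matrix of the
    Dirichlet kernels for the weight w. *)
Definition gram L k l : C :=
  (b ^ L)%:R^-1 * dirichlet_corr k l +
  \sum_(i < L.+1) (2 ^ (L - i))%:R * gram_term (b ^ i) k l.

Lemma laurent_gram L k l :
  laurent (fun z => dirichlet k z * dirichlet l z * dual_weight b L z)
    (gram L k l).
Proof.
have lD : laurent (fun z => dirichlet k z * dirichlet l z) (dirichlet_corr k l).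
  apply: laurent_ext (laurent_sum (fun i : 'I_(2 * k).+1 =>
    laurent_sum (fun j : 'I_(2 * l).+1 =>
      laurent_monomial 1 (i%:Z - k%:Z + (j%:Z - l%:Z))))) _ _.
    move=> z z1; rewrite mulr_suml; apply: eq_bigr => i _.
    rewrite mulr_sumr; apply: eq_bigr => j _.
    by rewrite mul1r expfzDr// unit_neq0.
  apply: eq_bigr => i _; apply: eq_bigr => j _; rewrite mul1r.
  by congr (nat_of_bool _)%:R; apply/eqP/eqP => ?; lia.
have lT m : laurent (fun z => `|1 - z| ^+ 2 *
    (dirichlet k z * dirichlet l z) * fejer m z) (gram_term m k l).
  apply: laurent_ext (laurentD (laurentD (laurentD
     (laurent_fejer m (l%:Z - k%:Z))
     (laurentZ (-1) (laurent_fejer m (- k%:Z - l%:Z - 1))))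
     (laurentZ (-1) (laurent_fejer m (k%:Z + l%:Z + 1))))
     (laurent_fejer m (k%:Z - l%:Z))) _ _.
    by move=> z z1; rewrite norm1B_dirichletM//; ring.
  by rewrite !mulN1r.
apply: laurent_ext (laurentD (laurentZ (b ^ L)%:R^-1 lD) (laurent_sum
  (fun i : 'I_L.+1 => laurentZ (2 ^ (L - i))%:R (lT (b ^ i)%N)))) _ _ => //.
move=> z z1; rewrite /dual_weight mulrDr; congr (_ + _); first exact: mulrC.
rewrite [RHS]mulrCA [RHS]mulrA [RHS]mulr_sumr; apply: eq_bigr => i _.
exact: mulrCA.
Qed.

(** The constant term of D_k D_l is at most 2k+1 <= 2 b^L, so the first summand
    is at most 2, and is absorbed by the scale i = L, where the band condition
    always holds. *)
Lemma gram_le L k l : (k < b ^ L)%N -> (l < b ^ L)%N ->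
  `|gram L k l| <=
  (4 * \sum_(i < L.+1) 2 ^ (L - i) * (`|k%:Z - l%:Z| < b ^ i))%N%:R.
Proof.
move=> kL lL.
have bC : 0 < (b ^ L)%:R :> C by rewrite ltr0n expn_gt0 b_gt0.
have h1 : `|(b ^ L)%:R^-1 * dirichlet_corr k l| <=
   (2 * \sum_(i < L.+1) 2 ^ (L - i) * (`|k%:Z - l%:Z| < b ^ i))%N%:R.
  apply: (@le_trans _ _ 2).
    rewrite ger0_norm; last first.
      by rewrite mulr_ge0 ?invr_ge0//; do 2!apply: sumr_ge0 => ? _.
    rewrite ler_pdivrMl//; apply: (@le_trans _ _ (\sum_(i < (2 * k).+1) 1)).
      by apply: ler_sum => i _; exact: indicator_le1.
    by rewrite sumr_const card_ord -natrM ler_nat; lia.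
  rewrite ler_nat big_ord_recr /= subnn expn0 mul1n.
  have -> : (`|k%:Z - l%:Z| < b ^ L)%N by lia.
  lia.
apply: le_trans (ler_normD _ _) _; rewrite (_ : 4 = 2 + 2)%N// mulnDl natrD lerD//.
apply: le_trans (ler_norm_sum _ _ _) _.
rewrite big_distrr natr_sum; apply: ler_sum => i _ /=.
rewrite normrM normr_nat mulnCA natrM ler_wpM2l// natrM.
exact: gram_term_le.
Qed.

Lemma gram_sum_le n L N : (2 ^ n.+1 <= b)%N -> (N <= b ^ L)%N ->
  \sum_(k < N) \sum_(l < N) `|gram L k l| ^+ n <= (4 * 8 ^ n * N * b ^ L)%:R.
Proof.
move=> nb Nb; apply: (@le_trans _ _ (\sum_(k < N) \sum_(l < N)
     (4 * \sum_(i < L.+1) 2 ^ (L - i) * (`|k%:Z - l%:Z| < b ^ i)) ^ n)%N%:R).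
  rewrite natr_sum; apply: ler_sum => k _; rewrite natr_sum.
  apply: ler_sum => l _; rewrite natrX lerXn2r ?nnegrE//.
  by apply: gram_le; apply: leq_trans Nb.
by rewrite ler_nat near_diagonal_sum.
Qed.

Definition majorant_mass L : C := \sum_(i < L.+1) (2 ^ (L - i))%:R^-1.
Definition majorant_moment L : C :=
  \sum_(i < L.+1) (2 ^ (L - i))%:R^-1 * (2 / (b ^ i)%:R).

Lemma laurent_majorant L : laurent (fejer_majorant b L) (majorant_mass L).
Proof.
apply: laurent_ext (laurent_sum (fun i : 'I_L.+1 =>
  laurentZ (2 ^ (L - i))%:R^-1 (laurent_fejer (b ^ i) 0))) _ _.
  by move=> z z1; apply: eq_bigr => i _; rewrite expr0z mulr1.
apply: eq_bigr => i _; rewrite (_ : fejer_coef _ _ = 1) ?mulr1//.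
have b0 : (b ^ i)%:R != 0 :> C by rewrite pnatr_eq0 -lt0n expn_gt0 b_gt0.
rewrite /fejer_coef (eq_bigr (fun=> 1)) ?sumr_const ?card_ord ?mulVf// => r _.
rewrite (bigD1 r)//= subr0 eqxx big1 ?addr0// => p pr.
by rewrite (_ : (_ == _) = false)//; apply/negbTE.
Qed.

Lemma laurent_majorant_moment L :
  laurent (fun z => `|1 - z| ^+ 2 * fejer_majorant b L z) (majorant_moment L).
Proof.
have bi0 i : (0 < b ^ i)%N by rewrite expn_gt0 b_gt0.
apply: laurent_ext (laurent_sum (fun i : 'I_L.+1 =>
  laurentZ (2 ^ (L - i))%:R^-1 (laurent_fejer_moment (bi0 i)))) _ _ => //.
by move=> z z1; rewrite mulr_sumr; apply: eq_bigr => i _; rewrite mulrCA.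
Qed.

Lemma majorant_mass_itv L : 0 <= majorant_mass L <= 2.
Proof.
apply/andP; split; first by apply: sumr_ge0 => i _; rewrite invr_ge0.
elim: L => [|L IH].
  by rewrite /majorant_mass big_ord1 invr1 ler1n.
rewrite /majorant_mass big_ord_recr/= subnn invr1.
have -> : \sum_(i < L.+1) (2 ^ (L.+1 - i))%:R^-1 = 2^-1 * majorant_mass L.
  rewrite mulr_sumr; apply: eq_bigr => i _.
  by rewrite subSn -1?ltnS// expnS natrM invfM.
rewrite -lerBrDr (_ : 2 - 1 = 2^-1 * 2); last by field.
by rewrite ler_wpM2l.
Qed.

Lemma majorant_moment_itv L : (4 <= b)%N ->
  0 <= majorant_moment L <= 4 / (2 ^ L)%:R.
Proof.
move=> b4; apply/andP; split.
  by apply: sumr_ge0 => i _; rewrite mulr_ge0 ?invr_ge0// divr_ge0.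
have h i : (2 : C) / (b ^ i)%:R <= 2 / (4 ^ i)%:R.
  rewrite ler_wpM2l// lef_pV2 ?posrE ?ltr0n ?expn_gt0 ?b_gt0// ler_nat.
  by case: i => // i; rewrite leq_exp2r.
apply: (@le_trans _ _
    (\sum_(i < L.+1) (2 ^ (L - i))%:R^-1 * (2 / (4 ^ i)%:R))).
  by apply: ler_sum => i _; rewrite ler_wpM2l ?invr_ge0.
have p2 i : (2 ^ i)%:R != 0 :> C by rewrite pnatr_eq0 -lt0n expn_gt0.
have -> : \sum_(i < L.+1) (2 ^ (L - i))%:R^-1 * (2 / (4 ^ i)%:R) =
    (2 / (2 ^ L)%:R) * majorant_mass L :> C.
  rewrite mulr_sumr (reindex_inj rev_ord_inj) /=; apply: eq_bigr => i _.
  have iL : (i <= L)%N by rewrite -ltnS.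
  rewrite subSS subKn// (_ : 4 = 2 * 2)%N// expnMn natrM.
  have -> : (2 ^ L)%:R = (2 ^ i)%:R * (2 ^ (L - i))%:R :> C.
    by rewrite -natrM -expnD subnKC.
  by field; rewrite !p2.
rewrite (_ : 4 / _ = 2 / (2 ^ L)%:R * 2); last by field; rewrite p2.
by rewrite ler_wpM2l ?divr_ge0//; case/andP: (majorant_mass_itv L).
Qed.

End Laurent.

Local Open Scope complex_scope.

(** * The Hahn-Banach theorem *)

Section HahnBanach.
Variables (R : realType) (V : lmodType R) (p : V -> R).

Definition sublinear : Prop :=
  (forall x y, p (x + y) <= p x + p y) /\
  (forall (t : R) x, 0 <= t -> p (t *: x) = t * p x).

(** Partial linear functionals are represented by their graphs, so that Zorn's
    lemma applies to plain inclusion of sets.  Domination by a sublinear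
    function forces such a graph to be single-valued. *)
Definition dominated_graph (G : set (V * R)) : Prop :=
  (forall (a : R) u v, G u -> G v -> G (a *: u.1 + v.1, a * u.2 + v.2)) /\
  (forall u, G u -> u.2 <= p u.1).

Hypothesis psub : sublinear.

(** The value c at the new vector has to satisfy
    u.2 - p (u.1 - x1) <= c <= p (v.1 + x1) - v.2 for all u and v in the graph;
    subadditivity of p makes these constraints compatible, and c is taken to be
    the supremum of the left-hand sides. *)
Lemma dominated_graph_extend (G : set (V * R)) (x1 : V) :
  dominated_graph G -> G !=set0 ->
  exists2 H, dominated_graph H & G `<=` H /\ exists c, H (x1, c).
Proof.
move=> [Glin Gle] [u0 Gu0].
have [pD pZ] := psub.
have p0 : p 0 = 0 by rewrite -(scale0r (0 : V)) pZ// mul0r.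
have G0 : G (0, 0).
  have := Glin (-1) _ _ Gu0 Gu0.
  by rewrite scaleN1r addNr mulN1r addNr.
have GZ a u : G u -> G (a *: u.1, a * u.2).
  by move=> Gu; have := Glin a _ _ Gu G0; rewrite !addr0.
pose S := [set s | exists2 u, G u & s = u.2 - p (u.1 - x1)].
have Sub u : G u -> ubound S (p (u.1 + x1) - u.2).
  move=> Gu _ [v Gv ->].
  rewrite lerBrDr addrAC lerBlDr.
  have /Gle/= := Glin 1 _ _ Gv Gu; rewrite scale1r mul1r => /le_trans; apply.
  rewrite (_ : v.1 + u.1 = (u.1 + x1) + (v.1 - x1)); last first.
    by rewrite addrACA subrr addr0 addrC.
  exact: pD.
have hS : has_sup S.
  split; first by exists (u0.2 - p (u0.1 - x1)), u0.
  by exists (p (u0.1 + x1) - u0.2); exact: Sub.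
pose c := sup S.
have cu u : G u -> u.2 + c <= p (u.1 + x1).
  move=> Gu; rewrite -lerBrDl; apply: ge_sup (Sub _ Gu).
  by case: hS.
have cl u : G u -> u.2 - c <= p (u.1 - x1).
  move=> Gu; rewrite lerBlDr addrC -lerBlDr.
  by apply: ub_le_sup; [by case: hS|exists u].
exists [set w | exists u t, G u /\ w = (u.1 + t *: x1, u.2 + t * c)].
  split.
    move=> a _ _ [u [t [Gu ->]]] [v [s [Gv ->]]]/=.
    exists (a *: u.1 + v.1, a * u.2 + v.2), (a * t + s); split; first exact: Glin.
    congr (_, _) => /=; last by ring.
    by rewrite scalerDr scalerDl scalerA addrACA.
  move=> _ [u [t [Gu ->]]]/=.
  have [t0|t0|->] := ltgtP t 0; last by rewrite scale0r mul0r !addr0; exact: Gle.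
    have Nt0 : 0 < - t by rewrite oppr_gt0.
    have := cl _ (GZ (- t)^-1 _ Gu).
    rewrite -(ler_pM2l Nt0) -(pZ _ _ (ltW Nt0))/= scalerBr scalerA mulrBr mulrA.
    by rewrite mulfV ?gt_eqF// scale1r mul1r scaleNr opprK mulNr opprK.
  have := cu _ (GZ t^-1 _ Gu).
  rewrite -(ler_pM2l t0) -(pZ _ _ (ltW t0))/= scalerDr scalerA mulrDr mulrA.
  by rewrite mulfV ?gt_eqF// scale1r mul1r.
split; first by move=> u Gu; exists u, 0; rewrite scale0r mul0r !addr0; case: u Gu.
by exists c; exists (0, 0), 1; rewrite scale1r mul1r !add0r.
Qed.

Lemma hahn_banach (y0 : V) :
  exists f : {scalar V}, (forall x, f x <= p x) /\ f y0 = p y0.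
Proof.
have [pD pZ] := psub.
have p0 : p 0 = 0 by rewrite -(scale0r (0 : V)) pZ// mul0r.
(* The condition is on nonempty graphs, so that the union of the empty chain
   satisfies it. *)
pose P := [set G | dominated_graph G /\ (G !=set0 -> G (y0, p y0))].
have [G [[Gdom Gy0] Gmax]] : exists A, P A /\ forall B, A `<` B -> ~ P B.
  apply: Zorn_bigcup => F FP Ftot; split; first split.
  - move=> a u v [A FA Au] [B FB Bv].
    have [AB|BA] := Ftot _ _ FA FB.
      by exists B => //; apply: (FP _ FB).1.1 => //; exact: AB.
    by exists A => //; apply: (FP _ FA).1.1 => //; exact: BA.
  - by move=> u [A FA Au]; exact: (FP _ FA).1.2.
  - by move=> [u [A FA Au]]; exists A => //; apply: (FP _ FA).2; exists u.
pose G0 := [set w : V * R | exists t, w = (t *: y0, t * p y0)].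
have G0dom : dominated_graph G0.
  split.
    move=> a _ _ [t ->] [s ->]/=; exists (a * t + s).
    by rewrite scalerDl scalerA mulrDl mulrA.
  move=> _ [t ->]/=; have [t0|t0] := leP 0 t; first by rewrite pZ.
  have := pD (t *: y0) (- t *: y0).
  have Nt0 : 0 <= - t by rewrite oppr_ge0 ltW.
  by rewrite -scalerDl subrr scale0r p0 (pZ _ _ Nt0) mulNr subr_ge0.
have G0y : G0 (y0, p y0) by exists 1; rewrite scale1r mul1r.
have Gn0 : G !=set0.
  apply/set0P/negP => /eqP G00.
  apply: (Gmax G0); last by split.
  rewrite G00; split; first by [].
  by move=> /(_ _ G0y).
have Gtot x : exists c, G (x, c).
  have [H Hdom [GH [c Hc]]] := dominated_graph_extend x Gdom Gn0.
  exists c; apply: contrapT => Gxc; apply: (Gmax H).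
    by split => // /(_ _ Hc).
  by split => // _; apply/GH/Gy0.
have [Glin Gle] := Gdom.
have Guniq x c d : G (x, c) -> G (x, d) -> c <= d.
  move=> Gc Gd; have /Gle/= := Glin (-1) _ _ Gd Gc.
  by rewrite scaleN1r addNr mulN1r p0 addrC subr_le0.
pose f x := sval (cid (Gtot x)).
have Gf x : G (x, f x) by rewrite /f; case: cid.
have flin : scalar f.
  move=> a x y; have Gl := Glin a _ _ (Gf x) (Gf y).
  by apply/eqP; rewrite eq_le !(Guniq _ _ _ (Gf _) Gl, Guniq _ _ _ Gl (Gf _)).
pose fL : {scalar V} := HB.pack f (GRing.isLinear.Build R V R *%R f flin).
exists fL; split; first by move=> x; exact: (Gle _ (Gf x)).
by apply/eqP; rewrite eq_le !(Guniq _ _ _ (Gf _) (Gy0 Gn0), Guniq _ _ _ (Gy0 Gn0) (Gf _)).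
Qed.
End HahnBanach.

(** * Seminorms and continuous functionals on a locally convex space *)

Section Seminorms.
Variables (R : realType) (X : tvsType R[i]).

(** Homogeneity for real scalars is the right condition here, as only the real
    parts of functionals are compared with seminorms; it asks for symmetric
    rather than balanced neighbourhoods. *)
Definition real_seminorm (p : X -> R) : Prop :=
  [/\ forall x y, p (x + y) <= p x + p y,
      forall (r : R) x, p (r%:C *: x) = `|r| * p x &
      forall e, 0 < e -> nbhs 0 [set x | p x < e]].

Section Gauge.
Variable V : set X.
Hypothesis V0 : nbhs 0 V.
Hypothesis Vconvex : forall (t : R) x y, 0 <= t <= 1 -> V x -> V y ->
  V (t%:C *: x + (1 - t)%:C *: y).
Hypothesis Vsym : forall x, V x -> V (- x).

Let dil (x : X) : set R := [set t | 0 < t /\ V (t^-1%:C *: x)].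

(** The Minkowski functional of V. *)
Definition gauge (x : X) : R := inf (dil x).

Let dil_lb x : lbound (dil x) 0.
Proof. by move=> t [/ltW]. Qed.

Let dil_has_lb x : has_lbound (dil x).
Proof. by exists 0; exact: dil_lb. Qed.

Let dil_up x s t : dil x s -> s <= t -> dil x t.
Proof.
move=> [s0 Vs] st; have t0 := lt_le_trans s0 st.
split=> //; have := @Vconvex (s / t) _ 0 _ Vs (nbhs_singleton V0).
rewrite scaler0 addr0 scalerA -rmorphM/= mulrAC divff ?gt_eqF// mul1r; apply.
by rewrite divr_ge0 ?(ltW s0) ?(ltW t0)//= ler_pdivrMr// mul1r.
Qed.

Let dil_neq0 x : dil x !=set0.
Proof.
have /= := @scale_continuous _ X (0, x) V; rewrite scale0r => /(_ V0).
move=> [[A B] [/= A0 Bx] AB].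
have [e e0 eA] : exists2 e : R[i], 0 < e & forall z, `|z| < e -> A z.
  have /nbhs_ballP[e /= e0 eA] := A0; exists e => // z ze.
  by apply: eA; rewrite -ball_normE /= sub0r normrN.
pose r := complex.Re e / 2.
have eE : e = (complex.Re e)%:C by rewrite RRe_real// gtr0_real.
have Re0 : 0 < complex.Re e by rewrite -ltcR -eE.
have r0 : 0 < r by rewrite divr_gt0.
exists r^-1; split; first by rewrite invr_gt0.
rewrite invrK; apply: (AB (r%:C, x)); split => /=; last exact: nbhs_singleton.
apply: eA; rewrite ger0_norm ?ler0c ?ltW//.
by rewrite eE ltcR /r ltr_pdivrMr// ltr_pMr// ltr1n.
Qed.

Let gauge_ge0 x : 0 <= gauge x.
Proof. exact: lb_le_inf. Qed.

Lemma gauge_lt1 x : gauge x < 1 -> V x.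
Proof.
move=> /inf_lt[//|t tx t1]; have [_] := dil_up tx (ltW t1).
by rewrite invr1 scale1r.
Qed.

Let gauge_le x t : dil x t -> gauge x <= t.
Proof. exact: ge_inf. Qed.

Lemma gauge_le1 x : V x -> gauge x <= 1.
Proof. by move=> Vx; apply: gauge_le; split; rewrite ?invr1 ?scale1r. Qed.

Let gaugeD x y : gauge (x + y) <= gauge x + gauge y.
Proof.
apply/ler_addgt0Pr => e e0.
have e2 : 0 < e / 2 by rewrite divr_gt0.
have [t tx te] := inf_adherent e2 (conj (dil_neq0 x) (dil_has_lb x)).
have [s sy se] := inf_adherent e2 (conj (dil_neq0 y) (dil_has_lb y)).
apply: (@le_trans _ _ (t + s)); last first.
  by rewrite [e]splitr addrACA lerD// ltW.
apply: gauge_le; move: tx sy => [t0 Vt] [s0 Vs].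
have ts0 : 0 < t + s by rewrite addr_gt0.
split=> //; have := @Vconvex (t / (t + s)) _ _ _ Vt Vs.
have -> : 1 - t / (t + s) = s / (t + s) by field; rewrite gt_eqF.
rewrite !scalerA -!rmorphM/= -!mulrA [_^-1 * t^-1]mulrC [_^-1 * s^-1]mulrC.
rewrite !mulrA !divff ?gt_eqF// !mul1r -scalerDr; apply.
by rewrite divr_ge0 ?(ltW t0) ?(ltW ts0)//= ler_pdivrMr// mul1r lerDl ltW.
Qed.

Let gaugeZ_le (r : R) x : 0 < r -> gauge (r%:C *: x) <= r * gauge x.
Proof.
move=> r0; rewrite mulrC -ler_pdivrMr//; apply: lb_le_inf => // t [t0 Vt].
rewrite ler_pdivrMr//; apply: gauge_le; split; first exact: mulr_gt0.
rewrite scalerA -rmorphM/= invfM mulrAC -mulrA mulfV ?gt_eqF// mulr1//.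
Qed.

Let gaugeN x : gauge (- x) = gauge x.
Proof.
congr inf; apply/seteqP; split => t [t0 Vt]; split=> //.
  by rewrite -[x]opprK scalerN; exact: Vsym.
by rewrite scalerN; exact: Vsym.
Qed.

Let gaugeZ (r : R) x : gauge (r%:C *: x) = `|r| * gauge x.
Proof.
have pos s y : 0 < s -> gauge (s%:C *: y) = s * gauge y.
  move=> s0; apply/eqP; rewrite eq_le gaugeZ_le//=.
  have si0 : 0 < s^-1 by rewrite invr_gt0.
  rewrite -ler_pdivlMl//; apply: le_trans (gaugeZ_le _ si0).
  by rewrite scalerA -rmorphM/= mulVf ?gt_eqF// scale1r.
have [r0|r0|->] := ltgtP r 0.
- by rewrite -gaugeN -scaleNr -rmorphN/= pos ?oppr_gt0// ltr0_norm.
- by rewrite pos// gtr0_norm.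
- rewrite normr0 mul0r scale0r; apply/eqP; rewrite eq_le gauge_ge0 andbT.
  apply/ler_addgt0Pr => e e0; rewrite add0r; apply: gauge_le; split=> //.
  by rewrite scaler0; exact: nbhs_singleton.
Qed.

Lemma gauge_seminorm : real_seminorm gauge.
Proof.
split=> // e e0.
have e20 : 0 < e / 2 by rewrite divr_gt0.
have ne : (e / 2)%:C != 0 :> R[i] by rewrite -ltcR in e20; rewrite gt_eqF.
apply: filterS (nbhs0Z ne V0) => _ [x Vx <-] /=.
rewrite gaugeZ gtr0_norm// (@le_lt_trans _ _ (e / 2))//.
  by rewrite ler_piMr ?gauge_le1// ltW.
by rewrite ltr_pdivrMr// ltr_pMr// ltr1n.
Qed.

End Gauge.

Lemma convex_set_segment (b : set X) (t : R) (x y : X) :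
  convex_set (M := X) b -> 0 <= t <= 1 -> b x -> b y ->
  b (t%:C *: x + (1 - t)%:C *: y).
Proof.
move=> bconv /andP[t0 t1] bx yb.
have t0C : 0 <= t%:C :> R[i] by rewrite ler0c.
have t1C : t%:C <= 1 :> R[i] by rewrite (lecR t 1).
have := bconv x y (Itv01 t0C t1C) (mem_set bx) (mem_set yb).
by rewrite inE rmorphB /conv /= /unstable.onem.
Qed.

Lemma seminorm_nbhs (U : set X) : nbhs 0 U ->
  exists2 p, real_seminorm p & forall x, p x < 1 -> U x.
Proof.
move=> U0; have [B Bconv [Bop Bb]] := @locally_convex _ X.
have [b [Bb0 b0] bU] := Bb 0 _ U0.
have bnbhs : nbhs 0 b by apply: open_nbhs_nbhs; split => //; exact: Bop.
pose V := b `&` (-%R @^-1` b).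
have bc := convex_set_segment (Bconv b (mem_set Bb0)).
have Vs x : V x -> V (- x) by move=> [? ?]; split=> //=; rewrite opprK.
have Vc t x y : 0 <= t <= 1 -> V x -> V y -> V (t%:C *: x + (1 - t)%:C *: y).
  move=> t01 [bx bNx] [yb bNy]; split; first exact: bc.
  by rewrite /= opprD -!scalerN; exact: bc.
have V0 : nbhs 0 V.
  apply: filterI => //; have := nbhs0N bnbhs.
  by apply: filterS => _ [x bx <-] /=; rewrite opprK.
exists (gauge V); first exact: gauge_seminorm.
by move=> x /(gauge_lt1 V0 Vc)[/bU].
Qed.

End Seminorms.

Section RestrictionOfScalars.
Variables (R : realType) (X : lmodType R[i]).

(** A complex space with its scalars restricted to the real numbers, under a
    new name to keep the two module structures apart. *)
Definition real_form : Type := X.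
HB.instance Definition _ := GRing.Zmodule.on real_form.

Let rscale (r : R) (x : real_form) : real_form := (r%:C : R[i]) *: (x : X).
Let rscaleA a b v : rscale a (rscale b v) = rscale (a * b) v.
Proof. by rewrite /rscale scalerA -rmorphM. Qed.
Let rscale1 : left_id 1 rscale.
Proof. by move=> v; rewrite /rscale rmorph1 scale1r. Qed.
Let rscaleDr : right_distributive rscale +%R.
Proof. by move=> a u v; rewrite /rscale scalerDr. Qed.
Let rscaleDl v : {morph rscale^~ v : a b / a + b}.
Proof. by move=> a b; rewrite /rscale rmorphD scalerDl. Qed.

HB.instance Definition _ := GRing.Zmodule_isLmodule.Build R real_form
  rscaleA rscale1 rscaleDr rscaleDl.

Lemma real_formZ (r : R) (x : real_form) : r *: x = (r%:C : R[i]) *: (x : X).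
Proof. by []. Qed.

End RestrictionOfScalars.

Section NormingFunctional.
Variables (R : realType) (X : tvsType R[i]).

Lemma additive_continuous (phi : {additive X -> R[i]^o}) :
  (forall e : R, 0 < e -> nbhs 0 [set x | `|phi x| < e%:C]) -> continuous phi.
Proof.
move=> phi0 x; apply/cvgrPdist_lt => e e0.
have eE : e = (complex.Re e)%:C by rewrite RRe_real// gtr0_real.
have Re0 : 0 < complex.Re e by rewrite -ltcR -eE.
have := nbhsT x (phi0 _ Re0); rewrite -eE; apply: filterS => _ [y /= ye <-].
by rewrite raddfD opprD addrA subrr add0r normrN.
Qed.

(** A real functional f dominated by p is the real part of the complex
    functional x |-> f x - i f (i x). *)
Lemma norming_functional (p : X -> R) (x0 : X) : real_seminorm p ->
  exists phi : {linear X -> R[i]^o}, [/\ continuous phi,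
    forall x, `|complex.Re (phi x)| <= p x & complex.Re (phi x0) = p x0].
Proof.
move=> [pD pZ pn].
have psub : sublinear (p : real_form X -> R).
  by split => // t x t0; rewrite real_formZ pZ ger0_norm.
have [f [fp fx0]] := hahn_banach psub (x0 : real_form X).
pose g (x : X) : R := f x.
have gD x y : g (x + y) = g x + g y by rewrite /g -raddfD.
have gZ r x : g (r%:C *: x) = r * g x by rewrite /g -linearZ.
have gp x : `|g x| <= p x.
  rewrite ler_norml fp andbT lerNl.
  have := fp (- x); rewrite raddfN => /le_trans; apply.
  have := pZ (-1) x; rewrite rmorphN rmorph1 scaleN1r normrN1 mul1r => ->.
  by [].
pose phi (x : X) : R[i]^o := g x +i* - g ('i *: x).
have philin : linear phi.
  move=> [a b] x y; rewrite /phi.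
  have aE z : (a +i* b) *: z = a%:C *: z + b%:C *: ('i *: z).
    by rewrite scalerA -scalerDl; congr (_ *: _); simpc.
  have iE z : 'i *: ((a +i* b) *: z) = a%:C *: ('i *: z) + (- b)%:C *: z.
    by rewrite !scalerA -scalerDl; congr (_ *: _); simpc.
  rewrite scalerDr iE aE !gD !gZ.
  apply/eqP; rewrite eq_complex /=; apply/andP; split; apply/eqP; ring.
pose phiL : {linear X -> R[i]^o} :=
  HB.pack phi (GRing.isLinear.Build R[i] X R[i]^o *:%R phi philin).
exists phiL; split => //; apply: additive_continuous => e e0.
have e20 : 0 < e / 2 by rewrite divr_gt0.
have ni0 : - 'i != 0 :> R[i] by rewrite oppr_eq0 eq_complex /= oner_eq0 andbF.
have n1 := pn _ e20; have n2 := nbhs0Z ni0 n1.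
apply: filterS (filterI n1 n2) => x /= [xe [y ye yx]].
have iy : 'i *: x = y.
  rewrite -yx scalerA.
  have -> : ('i * - 'i : R[i]) = 1 by rewrite mulrN -expr2 sqr_i opprK.
  exact: scale1r.
have -> : phi x = (g x)%:C - 'i * (g y)%:C.
  by rewrite /phi iy; simpc.
apply: le_lt_trans (ler_normB _ _) _.
rewrite normrM (_ : `|'i : R[i]| = 1) ?mul1r; last first.
  by rewrite normc_def /= expr0n add0r expr1n sqrtr1.
rewrite !normc_def /= expr0n !addr0 !sqrtr_sqr -rmorphD ltcR [e]splitr.
by apply: ltrD; apply: le_lt_trans (gp _) _.
Qed.

End NormingFunctional.

(** * Topology of the torus *)

Section ComplexTopology.
Variable R : realType.

Lemma real_complex_continuous : continuous (fun x : R => x%:C : R[i]^o).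
Proof.
move=> x; apply/cvgrPdist_lt => e e0.
have eE : e = (complex.Re e)%:C by rewrite RRe_real// gtr0_real.
have Re0 : 0 < complex.Re e by rewrite -ltcR -eE.
have /cvgrPdist_lt/(_ _ Re0) : (fun y : R => y) @ x --> x by exact: cvg_id.
apply: filterS => y xy.
by rewrite -rmorphB/= normc_def/= expr0n addr0 sqrtr_sqr eE ltcR.
Qed.

Lemma Re_continuous : continuous (@complex.Re R : R[i]^o -> R).
Proof.
move=> x A /nbhs_ballP[e /= e0 eA].
apply/nbhs_ballP; exists (e%:C : R[i]); first by rewrite /= ltcR.
move=> y; rewrite -ball_normE /= => xy; apply: eA; rewrite -ball_normE /=.
by rewrite -ltcR; apply: le_lt_trans xy; rewrite -raddfB normc_ge_Re.
Qed.

Lemma norm_Ni : `|- 'i : R[i]| = 1.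
Proof. by rewrite normrN normc_def /= expr0n add0r expr1n sqrtr1. Qed.

Lemma ImE (z : R[i]) : complex.Im z = complex.Re (- 'i * z).
Proof. by case: z => a b; simpc. Qed.

Lemma normc_ge_Im (z : R[i]) : `|complex.Im z|%:C <= `|z|.
Proof. by rewrite ImE (le_trans (normc_ge_Re _))// normrM norm_Ni mul1r. Qed.

Lemma Im_continuous : continuous (@complex.Im R : R[i]^o -> R).
Proof.
move=> x A /nbhs_ballP[e /= e0 eA].
apply/nbhs_ballP; exists (e%:C : R[i]); first by rewrite /= ltcR.
move=> y; rewrite -ball_normE /= => xy; apply: eA; rewrite -ball_normE /=.
rewrite -ltcR; apply: le_lt_trans xy; rewrite -raddfB.
exact: normc_ge_Im.
Qed.

Section PointwiseOperations.
Variables (S : topologicalType).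
Implicit Types f g : S -> R[i].
Local Notation continuousC f := (continuous ((f : S -> R[i]) : S -> R[i]^o)).

Lemma continuousC_cst (a : R[i]) : continuousC (fun _ : S => a).
Proof. by move=> x; exact: cvg_cst. Qed.

Lemma continuousCD f g : continuousC f -> continuousC g ->
  continuousC (fun x => f x + g x).
Proof.
by move=> cf cg x; exact: (@cvgD R[i] R[i]^o S (nbhs x) _ f g _ _ (cf x) (cg x)).
Qed.

Lemma continuousCM f g : continuousC f -> continuousC g ->
  continuousC (fun x => f x * g x).
Proof.
by move=> cf cg x; exact: (@cvgM R[i] S (nbhs x) _ f g _ _ (cf x) (cg x)).
Qed.

Lemma continuousCZ (a : R[i]) f : continuousC f ->
  continuousC (fun x => a * f x).
Proof. by move=> cf; exact: (continuousCM (@continuousC_cst a) cf). Qed.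

Lemma continuousCN f : continuousC f -> continuousC (fun x => - f x).
Proof.
by move=> cf x; exact: (@cvgN R[i] R[i]^o S (nbhs x) _ f _ (cf x)).
Qed.

Lemma continuousCV f : continuousC f -> (forall x, f x != 0) ->
  continuousC (fun x => (f x)^-1).
Proof.
by move=> cf f0 x; exact: (@cvgV R[i] S (nbhs x) _ f _ (f0 x) (cf x)).
Qed.

Lemma continuousCnorm f : continuousC f -> continuousC (fun x => `|f x|).
Proof. by move=> cf x; apply: (@cvg_norm R[i] R[i]^o); exact: cf. Qed.

Lemma continuousC_sum (I : Type) (r : seq I) (f : I -> S -> R[i]) :
  (forall i, continuousC (f i)) ->
  continuousC (fun x => \sum_(i <- r) f i x).
Proof.
move=> cf; elim: r => [|i r IH].
  by under eq_fun do rewrite big_nil; exact: continuousC_cst.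
by under eq_fun do rewrite big_cons; exact: (continuousCD (cf i) IH).
Qed.

Lemma continuousC_prod (I : Type) (r : seq I) (f : I -> S -> R[i]) :
  (forall i, continuousC (f i)) ->
  continuousC (fun x => \prod_(i <- r) f i x).
Proof.
move=> cf; elim: r => [|i r IH].
  by under eq_fun do rewrite big_nil; exact: continuousC_cst.
by under eq_fun do rewrite big_cons; exact: (continuousCM (cf i) IH).
Qed.

Lemma continuousCX f (m : nat) : continuousC f ->
  continuousC (fun x => f x ^+ m).
Proof.
move=> cf; elim: m => [|m IH].
  by under eq_fun do rewrite expr0; exact: continuousC_cst.
by under eq_fun do rewrite exprS; exact: (continuousCM cf IH).
Qed.

Lemma continuousCexpz f (e : int) : continuousC f -> (forall x, f x != 0) ->
  continuousC (fun x => f x ^ e).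
Proof.
move=> cf f0; case: e => m; first exact: continuousCX.
by apply: continuousCV => [|x]; [exact: continuousCX|rewrite expf_neq0].
Qed.

End PointwiseOperations.

(** A closed subset of the image of a square of the real plane. *)
Lemma unit_circle_compact : compact [set z : R[i]^o | `|z| = 1].
Proof.
pose g (u : R * R) : R[i]^o := (u.1)%:C + 'i * (u.2)%:C.
have gc : continuous g.
  apply: continuousCD => [u|].
    by apply: (@cvg_comp _ _ _ fst); [exact: cvg_fst|exact: real_complex_continuous].
  apply: continuousCZ => u.
  by apply: (@cvg_comp _ _ _ snd); [exact: cvg_snd|exact: real_complex_continuous].
have K : compact (g @` (`[-1, 1]%classic `*` `[-1, 1]%classic)).
  apply: continuous_compact; first exact: continuous_subspaceT.
  by apply: compact_setX; exact: segment_compact.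
apply: subclosed_compact K _.
  apply: (@closed_comp _ _ (fun z : R[i]^o => `|z| : R[i]^o) [set 1]).
    by move=> z _; exact: norm_continuous.
  apply: accessible_closed_set1; apply: hausdorff_accessible.
  exact: (@norm_hausdorff R[i] R[i]^o).
move=> z /= z1; exists (complex.Re z, complex.Im z); last by rewrite /g /= -complexE.
have bound (w : R[i]) : `|w| = 1 -> -1 <= complex.Re w <= 1.
  by move=> w1; have := normc_ge_Re w; rewrite w1 (lecR _ 1) ler_norml.
split; rewrite /= in_itv /=; first exact: bound.
by rewrite ImE; apply: bound; rewrite normrM norm_Ni mul1r.
Qed.

End ComplexTopology.

Section TorusTopology.
Variables (R : realType) (n : nat).
Local Notation T := (torus R n).

Lemma torus_val_continuous : continuous (@torus_val R n).
Proof. exact: initial_continuous. Qed.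

Lemma torus_coord_continuous (j : 'I_n) : continuous (fun l : T => l 0 j : R[i]^o).
Proof.
move=> l; apply: (@continuous_comp _ _ _ (@torus_val R n) (fun v : 'rV[R[i]^o]_n => v 0 j)).
  exact: torus_val_continuous.
exact: coord_continuous.
Qed.

(** Tychonoff in the space of row vectors, transported to the torus by its
    initial topology. *)
Lemma torus_compact : compact [set: T].
Proof.
move=> F PF _.
have GK : (@torus_val R n @ F) [set v | forall j, `|v ord0 j| = 1].
  by apply: (@filterE _ F) => t j; exact: torus_norm.
have [v [vK vF]] := @rV_compact _ _ (fun=> [set z : R[i]^o | `|z| = 1])
  (fun=> @unit_circle_compact R) _ (fmap_proper_filter _ PF) GK.
have vT : [forall j, `|v 0 j| == 1] by apply/forallP => j; apply/eqP/vK.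
exists (Torus vT); split => // A B FA.
rewrite nbhsE => -[U [[V Vop <-] Vv] UB].
have [||w [[t At <-] Vt]] := vF (@torus_val R n @` A) V.
- by apply: (@filterS _ F _ A) => // t At; exists t.
- by apply: open_nbhs_nbhs; split.
by exists t; split => //; apply: UB.
Qed.

Lemma torus_mul_continuous (s : T) : continuous (fun t : T => (s * t)%g).
Proof.
move=> t A; rewrite nbhsE => -[_ [[V Vop <-] Vv] UA].
apply: (@filterS _ (nbhs t) _ ((fun t' : T => torus_val (s * t')%g) @^-1` V)).
  by move=> t' Vt'; exact: UA.
have [P Pn PV] : nbhs (torus_val (s * t)%g) V by apply: open_nbhs_nbhs.
have : \forall t' \near t, forall i j, P i j (torus_val (s * t')%g i j).
  apply: (@filter_forall T _ (fun i t' =>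
    forall j, P i j (torus_val (s * t')%g i j)) (nbhs t)) => i.
  apply: (@filter_forall T _ (fun j t' =>
    P i j (torus_val (s * t')%g i j)) (nbhs t)) => j.
  rewrite (ord1 i); have := Pn 0 j; rewrite !mxE => Pj.
  have cj : (fun t' : T => (s 0 j : R[i]) * t' 0 j : R[i]^o) @ t -->
      ((s 0 j : R[i]) * t 0 j : R[i]^o).
    by apply: continuousCZ; exact: torus_coord_continuous.
  by apply: (@filterS _ (nbhs t) _ _ _ _ (cj _ Pj)) => t'; rewrite /= mxE.
by apply: (@filterS T (nbhs t)) => t' Pt'; apply: PV => i j; exact: Pt'.
Qed.

End TorusTopology.

(** * Integration of continuous functions on the torus *)

Section ContinuousIntegrals.
Variables (R : realType) (n : nat).
Local Notation T := (torus R n).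
Variable mu : probability T R.

Lemma torus_continuous_measurable (f : T -> R) :
  continuous f -> measurable_fun [set: T] f.
Proof.
move=> /continuousP cf; apply: (measurability _ (RGenOpens.measurableE R)).
move=> _ [_ [a [b ->] <-]]; rewrite setTI.
by apply: sub_gen_smallest; apply: cf; exact: interval_open.
Qed.

Lemma torus_continuous_bounded (f : T -> R) : continuous f ->
  exists M, forall t, `|f t| <= M.
Proof.
move=> cf; have : compact (f @` [set: T]).
  by apply: continuous_compact; [exact: continuous_subspaceT|exact: torus_compact].
move=> /(@compact_bounded R R^o)[M [_ MP]]; exists (M + 1) => t.
by apply: (MP (M + 1)); [rewrite ltrDl|exists t].
Qed.

Lemma torus_continuous_integrable (f : T -> R) : continuous f ->
  mu.-integrable [set: T] (EFin \o f).
Proof.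
move=> cf; apply: measurable_bounded_integrable => //.
- by rewrite ltey_eq fin_num_measure.
- exact: torus_continuous_measurable.
- have [M MP] := torus_continuous_bounded cf; exists M; split => [|x Mx t _].
    exact: num_real.
  exact: le_trans (MP t) (ltW Mx).
Qed.

Lemma torus_RintegralD (f g : T -> R) : continuous f -> continuous g ->
  \int[mu]_t (f t + g t) = \int[mu]_t f t + \int[mu]_t g t.
Proof. by move=> cf cg; apply: RintegralD => //; exact: torus_continuous_integrable. Qed.

Lemma torus_RintegralZl (f : T -> R) (a : R) : continuous f ->
  \int[mu]_t (a * f t) = a * \int[mu]_t f t.
Proof. by move=> cf; apply: RintegralZl => //; exact: torus_continuous_integrable. Qed.

Lemma torus_Rintegral_cst (a : R) : \int[mu]_t a = a.
Proof.
rewrite Rintegral_cst//; apply: etrans (mulr1 a).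
exact: (congr1 (fun u => a * fine u) (probability_setT mu)).
Qed.

Lemma torus_le_Rintegral (f g : T -> R) : continuous f -> continuous g ->
  (forall t, f t <= g t) -> \int[mu]_t f t <= \int[mu]_t g t.
Proof.
by move=> cf cg fg; apply: le_Rintegral => //; exact: torus_continuous_integrable.
Qed.

Hypothesis mu_haar : haar mu.

Lemma haar_Rintegral_shift (s : T) (f : T -> R) : continuous f ->
  \int[mu]_t f (s * t)%g = \int[mu]_t f t.
Proof.
move=> cf; rewrite /Rintegral; congr fine.
pose phi (t : T) : T := (s * t)%g.
have mphi : measurable_fun [set: T] phi.
  apply: (@measurability _ _ T T [set: T] phi (@open T)) => //.
  move=> _ [U Uop <-]; rewrite setTI; apply: sub_gen_smallest.
  by move/continuousP: (@torus_mul_continuous R n s); exact.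
transitivity (\int[pushforward mu phi]_t (f t)%:E)%E; last first.
  apply: eq_measure_integral => A mA _; rewrite /pushforward.
  apply: etrans (mu_haar (s^-1)%g mA); congr (mu _).
  apply/seteqP; split=> [t At|_ [t At <-]] /=; last by rewrite /phi /= mulVKg.
  by exists (s * t)%g => //; rewrite mulKg.
rewrite integral_pushforward//.
  by apply/measurable_EFinP; exact: torus_continuous_measurable.
rewrite /comp; apply: (@torus_continuous_integrable (f \o phi)).
by move=> t; apply: continuous_comp; [exact: torus_mul_continuous|exact: cf].
Qed.

End ContinuousIntegrals.

Section ComplexIntegrals.
Variables (R : realType) (n : nat).
Local Notation T := (torus R n).
Local Notation C := (R[i]).
Variable mu : probability T R.
Implicit Types f g : T -> R[i]^o.

Lemma continuous_Re f : continuous f -> continuous (fun t => complex.Re (f t)).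
Proof.
by move=> cf t; apply: (@cvg_comp _ _ _ f (@complex.Re R)); [exact: cf|exact: Re_continuous].
Qed.

Lemma continuous_Im f : continuous f -> continuous (fun t => complex.Im (f t)).
Proof.
by move=> cf t; apply: (@cvg_comp _ _ _ f (@complex.Im R)); [exact: cf|exact: Im_continuous].
Qed.

Lemma cintegral_ext f g : (forall t, f t = g t) -> cintegral mu f = cintegral mu g.
Proof. by move=> fg; congr cintegral; apply/funext. Qed.

Lemma cintegralD f g : continuous f -> continuous g ->
  cintegral mu (fun t => f t + g t : C) = cintegral mu f + cintegral mu g.
Proof.
move=> cf cg; rewrite /cintegral.
under eq_Rintegral do rewrite raddfD.
under [in X in _ +i* X]eq_Rintegral do rewrite raddfD.
by rewrite !torus_RintegralD//;
  [exact: continuous_Im|exact: continuous_Im|exact: continuous_Re|exact: continuous_Re].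
Qed.

Lemma cintegralZ (a : C) f : continuous f ->
  cintegral mu (fun t => a * f t : C) = a * cintegral mu f.
Proof.
move=> cf; case: a => a b; rewrite /cintegral.
have cR := continuous_Re cf; have cI := continuous_Im cf.
have cc (c : R) (h : T -> R) : continuous h -> continuous (fun t => c * h t).
  by move=> ch t; exact: (@cvgM R T (nbhs t) _ (fun=> c) h _ _ (cvg_cst _) (ch t)).
have -> : \int[mu]_t complex.Re ((a +i* b) * f t) =
    \int[mu]_t (a * complex.Re (f t) + (- b) * complex.Im (f t)).
  by apply: eq_Rintegral => t _; case: (f t) => u v; simpc => /=; rewrite ?mulNr.
have -> : \int[mu]_t complex.Im ((a +i* b) * f t) =
    \int[mu]_t (a * complex.Im (f t) + b * complex.Re (f t)).
  by apply: eq_Rintegral => t _; case: (f t) => u v; simpc => /=.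
by rewrite !torus_RintegralD ?torus_RintegralZl//; try exact: cc; simpc; rewrite ?mulNr.
Qed.

Lemma cintegral_cst (a : C) : cintegral mu (fun=> a) = a.
Proof. by rewrite /cintegral !torus_Rintegral_cst; case: a. Qed.

Lemma cintegral_sum (I : Type) (r : seq I) (f : I -> T -> R[i]^o) :
  (forall i, continuous (f i)) ->
  cintegral mu (fun t => \sum_(i <- r) f i t : C) = \sum_(i <- r) cintegral mu (f i).
Proof.
move=> cf; elim: r => [|i r IH].
  by rewrite big_nil -[RHS]cintegral_cst; apply: cintegral_ext => t; rewrite big_nil.
rewrite big_cons -IH -cintegralD//; last exact: continuousC_sum.
by apply: cintegral_ext => t; rewrite big_cons.
Qed.

Lemma le_cintegral f g : continuous f -> continuous g ->
  (forall t, f t <= g t :> C) -> cintegral mu f <= cintegral mu g.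
Proof.
move=> cf cg fg; rewrite lecE /=; apply/andP; split; last first.
  apply: torus_le_Rintegral; [exact: continuous_Re|exact: continuous_Re|].
  by move=> t; have := fg t; rewrite lecE => /andP[].
apply/eqP; apply: eq_Rintegral => t _.
by have := fg t; rewrite lecE => /andP[/eqP].
Qed.

(** The hypothesis forces g to be real, so both sides are real integrals. *)
Lemma norm_Re_cintegral_le f g : continuous f -> continuous g ->
  (forall t, `|complex.Re (f t)|%:C <= (g t : C)) ->
  `|complex.Re (cintegral mu f)|%:C <= cintegral mu g.
Proof.
move=> cf cg fg.
have gRe t : g t = (complex.Re (g t))%:C :> C.
  rewrite RRe_real//; apply: ger0_real; apply: le_trans (fg t).
  by rewrite ler0c.
have fg' t : `|complex.Re (f t)| <= complex.Re (g t).
  by have := fg t; rewrite gRe lecR.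
have -> : cintegral mu g = (\int[mu]_t complex.Re (g t))%:C.
  rewrite /cintegral (_ : \int[mu]_t complex.Im (g t) = 0)//.
  rewrite -[RHS](torus_Rintegral_cst mu); apply: eq_Rintegral => t _.
  by rewrite gRe.
have cR := continuous_Re cf; have cG := continuous_Re cg.
have cNG : continuous (fun t => -1 * complex.Re (g t)).
  by move=> t; exact: (@cvgM R T (nbhs t) _ (fun=> -1) _ _ _ (cvg_cst _) (cG t)).
rewrite lecR /= ler_norml; apply/andP; split.
  rewrite -mulN1r -torus_RintegralZl//; apply: torus_le_Rintegral => // t.
  by rewrite mulN1r; have := fg' t; rewrite ler_norml => /andP[].
apply: torus_le_Rintegral => // t.
by have := fg' t; rewrite ler_norml => /andP[].
Qed.

Hypothesis mu_haar : haar mu.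

Lemma cintegral_shift (s : T) f : continuous f ->
  cintegral mu (fun t => f (s * t)%g) = cintegral mu f.
Proof.
move=> cf; rewrite /cintegral.
rewrite (haar_Rintegral_shift mu_haar s (continuous_Re cf)).
by rewrite (haar_Rintegral_shift mu_haar s (continuous_Im cf)).
Qed.

Lemma torus_neq0 (l : T) j : l 0 j != 0.
Proof. by rewrite -normr_gt0 torus_norm ltr01. Qed.

Lemma continuous_char (a : {ffun 'I_n -> int}) :
  continuous (torus_char a : T -> R[i]^o).
Proof.
apply: continuousC_prod => j; apply: continuousCexpz => [|l].
  exact: torus_coord_continuous.
exact: torus_neq0.
Qed.

Lemma torus_charM (a : {ffun 'I_n -> int}) (s t : T) :
  torus_char a (s * t)%g = torus_char a s * torus_char a t.
Proof.
rewrite /torus_char -big_split/=; apply: eq_bigr => j _.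
by rewrite mxE expfzMl.
Qed.

(** If a_j is nonzero, take the |a_j|-th root of -1 as j-th coordinate and 1
    elsewhere; the character then takes the value -1. *)
Lemma torus_char_separated (a : {ffun 'I_n -> int}) : a != 0 ->
  exists s : T, torus_char a s != 1.
Proof.
move=> a0; have [j aj] : exists j, a j != 0.
  apply/existsP; apply: contraNT a0; rewrite negb_exists => /forallP a0.
  by apply/eqP/ffunP => j; rewrite ffunE; apply/eqP; rewrite -[_ == _]negbK a0.
have m0 : (0 < `|a j|)%N by rewrite absz_gt0.
pose u : C := (`|a j|%N.-root (-1))%R.
have um : u ^+ `|a j|%N = -1 by rewrite rootCK.
have u1 : `|u| = 1.
  apply/eqP; rewrite -(@pexpr_eq1 _ _ `|a j|%N)// -normrX um.
  by rewrite normrN1.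
have sP : [forall k, `|(\row_k (if k == j then u else 1) : 'rV[R[i]^o]_n) 0 k| == 1].
  by apply/forallP => k; rewrite mxE; case: ifP; rewrite ?u1 ?normr1.
exists (Torus sP); rewrite /torus_char (bigD1 j)//= big1 ?mulr1; last first.
  by move=> k kj; rewrite mxE (negbTE kj) exp1rz.
rewrite mxE eqxx.
have -> : u ^ a j = -1.
  case: (a j) um => m um; first exact: um.
  by rewrite /exprz; move: um => /= ->; rewrite invrN invr1.
by rewrite eq_sym -subr_eq0 opprK -mulr2n pnatr_eq0.
Qed.

(** Translation by s multiplies the integral by the value of the character at
    s, which can be chosen different from 1. *)
Lemma cintegral_char (a : {ffun 'I_n -> int}) :
  cintegral mu (torus_char a) = (a == 0)%:R.
Proof.
have [->|a0] := eqVneq a 0.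
  rewrite -[RHS]cintegral_cst; apply: cintegral_ext => t.
  by rewrite /torus_char big1// => j _; rewrite ffunE expr0z.
have [s s1] := torus_char_separated a0.
have := cintegral_shift s (@continuous_char a).
under cintegral_ext do rewrite torus_charM.
rewrite cintegralZ; last exact: continuous_char.
move/eqP; rewrite -subr_eq0 -[X in _ - X]mul1r -mulrBl mulf_eq0 subr_eq0.
by rewrite (negbTE s1) => /eqP.
Qed.

(** A substitute for Fubini's theorem: expanded into characters, the product
    keeps only the term in which every exponent is zero. *)
Lemma cintegral_laurent_prod (f : C -> C) (c : C) : laurent f c ->
  cintegral mu (fun t : T => \prod_(j < n) f (t 0 j)) = c ^+ n.
Proof.
move=> [m [a [e [fE ->]]]].
pose alpha (g : {ffun 'I_n -> 'I_m}) : {ffun 'I_n -> int} := [ffun j => e (g j)].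
pose A (g : {ffun 'I_n -> 'I_m}) : C := \prod_j a (g j).
transitivity (cintegral mu (fun t : T => \sum_g A g * torus_char (alpha g) t)).
  apply: cintegral_ext => t.
  under eq_bigr => j _ do rewrite fE ?torus_norm//.
  rewrite bigA_distr_bigA /=; apply: eq_bigr => g _.
  by rewrite big_split /=; congr (_ * _); apply: eq_bigr => j _; rewrite ffunE.
rewrite cintegral_sum; last by move=> g; apply: continuousCZ; exact: continuous_char.
rewrite -[n in RHS]card_ord -prodr_const bigA_distr_bigA /=; apply: eq_bigr => g _.
rewrite cintegralZ; last exact: continuous_char.
rewrite cintegral_char big_split; congr (_ * _) => /=.
have [/ffunP g0|g0] := eqVneq (alpha g) 0.
  rewrite big1// => j _; have := g0 j; rewrite !ffunE => ->; by rewrite eqxx.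
apply/esym/eqP; rewrite prodf_seq_eq0; apply: contraNT g0 => /hasPn h.
apply/eqP/ffunP => j; rewrite !ffunE; apply/eqP.
by have := h j (mem_index_enum _); rewrite /= pnatr_eq0 eqb0 negbK.
Qed.

End ComplexIntegrals.

(** * Existence of weak integrals of continuous functions *)

Section Pettis.
Variables (R : realType) (n : nat) (X : tvsType R[i]).
Local Notation T := (torus R n).
Variable mu : probability T R.

Definition real_linear (g : X -> R) : Prop :=
  forall (a : R) x y, g (a%:C *: x + y) = a * g x + g y.

Lemma Re_real_linear (phi : {linear X -> R[i]^o}) :
  real_linear (fun x => complex.Re (phi x)).
Proof.
by move=> a x y; rewrite linearP; case: (phi x) (phi y) => u v [u' v']; simpc.
Qed.

Lemma Im_real_linear (phi : {linear X -> R[i]^o}) :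
  real_linear (fun x => complex.Im (phi x)).
Proof.
by move=> a x y; rewrite linearP; case: (phi x) (phi y) => u v [u' v']; simpc.
Qed.

Section RealLinear.
Variable (g : X -> R).
Hypothesis gP : real_linear g.

Lemma real_linear0 : g 0 = 0.
Proof.
by have := gP (-1) 0 0; rewrite scaler0 addr0 mulN1r addNr.
Qed.

Lemma real_linearD x y : g (x + y) = g x + g y.
Proof. by have := gP 1 x y; rewrite scale1r mul1r. Qed.

Lemma real_linearB x y : g (x - y) = g x - g y.
Proof.
have := gP (-1) y x; rewrite rmorphN rmorph1 scaleN1r mulN1r.
by rewrite addrC => ->; rewrite addrC.
Qed.

End RealLinear.

(** Selecting the first set that contains the point lets overlapping sets act as
    a partition. *)
Fixpoint step_function (s : seq (set T * X)) (t : T) : X :=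
  if s is (V, c) :: s' then if `[< V t >] then c else step_function s' t else 0.

Let masked (D : set T) (f : T -> R) (t : T) : R := \1_D t * f t.

(** A single vector y integrates the step function against all functionals at
    once.  Restricting to an arbitrary D lets the induction pass to the
    complement of the first set. *)
Lemma integral_step_function (s : seq (set T * X)) :
  (forall V c, List.In (V, c) s -> measurable V) ->
  forall D : set T, measurable D -> exists y : X, forall g, real_linear g ->
    mu.-integrable [set: T] (EFin \o masked D (g \o step_function s)) /\
    \int[mu]_t masked D (g \o step_function s) t = g y.
Proof.
elim: s => [|[V c] s IH] ms D mD.
  exists 0 => g glin; rewrite (real_linear0 glin).
  have -> : masked D (g \o step_function [::]) = fun=> 0.
    by apply/funext => t; rewrite /masked /= (real_linear0 glin) mulr0.
  by rewrite torus_Rintegral_cst; split => //; exact: integrable0.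
have mV : measurable V by apply: (ms V c); left.
have ms' V' c' : List.In (V', c') s -> measurable V'.
  by move=> h; apply: (ms V' c'); right.
have mDV : measurable (D `\` V) by exact: measurableD.
have mDIV : measurable (D `&` V) by exact: measurableI.
have [y yP] := IH ms' _ mDV.
exists ((fine (mu (D `&` V)))%:C *: c + y) => g glin.
have [gi gE] := yP g glin.
have split_ind : masked D (g \o step_function ((V, c) :: s)) =
   (fun t => g c * \1_(D `&` V) t + masked (D `\` V) (g \o step_function s) t).
  apply/funext => t; rewrite /masked /= !indicE in_setI in_setD.
  case: asboolP => Vt; first by rewrite (mem_set Vt) andbT andbF mul0r addr0 mulrC.
  by rewrite (memNset Vt) andbF andbT mulr0 add0r.
have i1 : mu.-integrable [set: T] (EFin \o (\1_(D `&` V) : T -> R)).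
  exact: integrable_indic.
have i1c : mu.-integrable [set: T] (EFin \o (fun t => g c * \1_(D `&` V) t)).
  exact: (integrableZl measurableT (g c) i1).
rewrite split_ind; split.
  have := integrableD measurableT i1c gi.
  by apply: eq_integrable => // t _ /=.
rewrite RintegralD// gE RintegralZl// glin; congr (_ + _).
rewrite mulrC; congr (_ * _).
by rewrite /Rintegral integral_indic// setIT.
Qed.

(** By compactness finitely many open sets cover the torus on each of which F
    varies by an element of U, so a step function approximates F up to U
    everywhere. *)
Lemma riemann_sum (F : T -> X) (U : set X) : continuous F -> nbhs 0 U ->
  exists y : X, forall g, real_linear g -> continuous g ->
    forall e, (forall z, U z -> `|g z| <= e) ->
      `|g y - \int[mu]_t g (F t)| <= e.
Proof.
move=> cF U0.
pose V (t : T) : set T := [set t' | U (F t' - F t)]^°.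
have Vt t : V t t.
  apply: (@filterS _ (nbhs t) _ _ _ _ (cF t _ (nbhsT (F t) U0))) => t' [z Uz zt'].
  by rewrite /= -zt' addrAC subrr add0r.
have Tc : cover_compact [set: T] by rewrite -compact_cover; exact: torus_compact.
have [||D _ Dcov] := Tc T setT V.
- by move=> t _; exact: open_interior.
- by move=> t _; exists t.
pose s := [seq (V t, F t) | t <- finmap.enum_fset D].
have sP W c : List.In (W, c) s -> exists t, W = V t /\ c = F t.
  rewrite /s; elim: (finmap.enum_fset D) => [//|t r IH] /= [[<- <-]|/IH//].
  by exists t.
have ms W c : List.In (W, c) s -> measurable W.
  move=> /sP[t [-> _]]; apply: sub_gen_smallest; exact: open_interior.
have [y yP] := integral_step_function ms measurableT.
have Us t : U (F t - step_function s t).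
  have [t0 t0D tV] := Dcov t I.
  have : List.Exists (fun p => p.1 t) s.
    have : t0 \in finmap.enum_fset D by exact: t0D.
    rewrite /s; elim: (finmap.enum_fset D) => [//|t1 r IH] /=.
    rewrite in_cons => /orP[/eqP <-|/IH]; first by left.
    by right.
  have : forall W c, List.In (W, c) s -> W t -> U (F t - c).
    by move=> W c /sP[t' [-> ->]] /interior_subset.
  elim: s {ms sP yP} => [_ /List.Exists_nil//|[W c] s IH] sU sE /=.
  case: asboolP => Wt; first by apply: (sU W c) => //; left.
  apply: IH; first by move=> W' c' h; apply: sU; right.
  by case/List.Exists_cons: sE.
exists y => g glin gcont e gU.
have [gi gE] := yP g glin.
have oneE : masked [set: T] (g \o step_function s) = g \o step_function s.
  by apply/funext => t; rewrite /masked indicE in_setT mul1r.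
rewrite oneE in gi gE.
have cgF : continuous (fun t => g (F t)).
  by move=> t; apply: (@cvg_comp _ _ _ F g); [exact: cF|exact: gcont].
have igF := torus_continuous_integrable mu cgF.
rewrite -gE -RintegralB//.
apply: le_trans (le_normr_Rintegral _ _) _ => //.
  by have := integrableB measurableT gi igF; apply: eq_integrable.
rewrite -[leRHS](torus_Rintegral_cst mu); apply: le_Rintegral => //.
- have := integrable_norm (integrableB measurableT gi igF).
  by apply: eq_integrable.
- exact: finite_measure_integrable_cst.
- by move=> t _; rewrite distrC -real_linearB//; exact/gU/Us.
Qed.

End Pettis.

Section PettisExists.
Variables (R : realType) (n : nat) (X : tvsType R[i]).
Local Notation T := (torus R n).
Variable mu : probability T R.
Hypothesis X_complete : complete_tvs X.

Lemma real_linear_small (g : X -> R) e : real_linear g -> continuous g -> 0 < e ->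
  nbhs 0 [set x | `|g x| < e].
Proof.
move=> glin cg e0; have /cvgrPdist_lt/(_ e e0) := cg 0.
by apply: filterS => x /=; rewrite real_linear0// sub0r normrN.
Qed.

(** The Riemann sums attached to the neighbourhoods of 0, ordered by reverse
    inclusion, form a Cauchy net: for a functional that is at most 1/3 in
    absolute value on a neighbourhood, two finer sums are both within 1/3 of
    the integral, and norming functionals turn this into an estimate of their
    difference. *)
Lemma is_pettis_integral_exists (F : T -> X) : continuous F ->
  exists y, is_pettis_integral mu F y.
Proof.
move=> cF.
pose I := {U : set X | nbhs 0 U}.
pose le (U V : I) := sval V `<=` sval U.
pose u (U : I) : X := sval (cid (riemann_sum mu cF (svalP U))).
have uP (U : I) : forall g, real_linear g -> continuous g ->
    forall e, (forall z, sval U z -> `|g z| <= e) ->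
      `|g (u U) - \int[mu]_t g (F t)| <= e.
  by rewrite /u; case: cid.
have dle : directed le.
  split; first by constructor; exists setT; exact: filterT.
  - by move=> U.
  - by move=> U V W UV VW; apply: subset_trans UV.
  - move=> U V; exists (exist _ (sval U `&` sval V) (filterI (svalP U) (svalP V))).
    by split => x /= [].
have cu : cauchy_net le u.
  move=> W W0; have [p psem pW] := seminorm_nbhs W0.
  have e3 : 0 < (3 : R)^-1 by [].
  have [_ _ /(_ _ e3) p3] := psem.
  exists (exist _ _ p3) => U V leU leV; apply: pW.
  have [phi [cphi phip <-]] := norming_functional (u U - u V) psem.
  have glin := Re_real_linear phi.
  have cg : continuous (fun x => complex.Re (phi x)).
    by move=> x; apply: (@cvg_comp _ _ _ phi (@complex.Re R)); [exact: cphi|exact: Re_continuous].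
  have small (W' : I) : le (exist _ _ p3) W' ->
      `|complex.Re (phi (u W')) - \int[mu]_t complex.Re (phi (F t))| <= 3^-1.
    move=> leW; apply: (uP W' _ glin cg) => z /leW /= pz.
    by rewrite (le_trans (phip z))// ltW.
  have := small U leU; have := small V leV.
  rewrite (real_linearB glin) !ler_norml => /andP[? ?] /andP[? ?]; lra.
have [y uy] := X_complete dle cu.
have key (g : X -> R) : real_linear g -> continuous g ->
    g y = \int[mu]_t g (F t).
  move=> glin cg; apply/eqP; rewrite eq_sym -subr_eq0 -normr_le0.
  apply/ler_addgt0Pr => e e0; rewrite add0r.
  have e20 : 0 < e / 2 by rewrite divr_gt0.
  have n1 := real_linear_small glin cg e20.
  have ny : nbhs y [set z | `|g z - g y| < e / 2].
    have := nbhsT y n1; apply: filterS => _ [z /= gz <-].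
    by rewrite real_linearD// addrAC subrr add0r.
  have [U0 U0P] := uy _ ny.
  have V1 : nbhs 0 (sval U0 `&` [set x | `|g x| < e / 2]).
    by apply: filterI => //; exact: svalP.
  pose U1 : I := exist _ _ V1.
  have /= h1 : `|g (u U1) - g y| < e / 2 by apply: U0P => z [].
  have h2 : `|g (u U1) - \int[mu]_t g (F t)| <= e / 2.
    by apply: uP => // z [_ /ltW].
  rewrite (le_trans (ler_distD (g (u U1)) _ _))// [e]splitr lerD//.
    by rewrite distrC.
  exact: ltW.
exists y => phi cphi; rewrite /cintegral.
rewrite -(key _ (Re_real_linear phi)); last first.
  by move=> x; apply: (@cvg_comp _ _ _ phi (@complex.Re R)); [exact: cphi|exact: Re_continuous].
rewrite -(key _ (Im_real_linear phi)); last first.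
  by move=> x; apply: (@cvg_comp _ _ _ phi (@complex.Im R)); [exact: cphi|exact: Im_continuous].
by case: (phi y).
Qed.

Lemma pettis_integralP (F : T -> X) : continuous F ->
  is_pettis_integral mu F (pettis_integral mu F).
Proof. by move=> /is_pettis_integral_exists[y yP]; apply: xgetPex; exists y. Qed.

End PettisExists.

Lemma continuous_scale (R : realType) (S : topologicalType) (X : tvsType R[i])
    (f : S -> R[i]^o) (u : S -> X) :
  continuous f -> continuous u -> continuous (fun t => f t *: u t).
Proof.
move=> cf cu t A /(scale_continuous (f t, u t))[[P Q] [/= nP nQ] PQ].
have PQt : nbhs t (f @^-1` P `&` u @^-1` Q).
  by apply: filterI; [exact: cf|exact: cu].
apply: filterS PQt.
by move=> t' [Pt Qt]; exact: (PQ (f t', u t') (conj Pt Qt)).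
Qed.

(** * The kernel of the Cesaro means *)

Section CesaroKernel.
Variables (R : realType) (n : nat).
Local Notation T := (torus R n).
Local Notation C := (R[i]).

(** The Fejer kernel for n = 1, the Marcinkiewicz kernel in general. *)
Definition cesaro_kernel (N : nat) (l : T) : C :=
  N.+1%:R^-1 * \sum_(k < N.+1) \prod_(j < n) dirichlet k (l 0 j : C).

(** The multi-indices are parametrised by k - g rather than by g - k because the
    Fourier components involve the opposite character. *)
Lemma square_dirichlet (k : nat) (V : lmodType C) (F : {ffun 'I_n -> int} -> V) :
  \sum_(a \in [set a : {ffun 'I_n -> int} | (sup_norm a <= k)%N]) F a =
  \sum_(g : {ffun 'I_n -> 'I_(2 * k).+1}) F [ffun j => k%:Z - (g j)%:Z].
Proof.
pose beta (g : {ffun 'I_n -> 'I_(2 * k).+1}) : {ffun 'I_n -> int} :=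
  [ffun j => k%:Z - (g j)%:Z].
have beta_inj : injective beta.
  move=> g h /ffunP gh; apply/ffunP => j; apply: val_inj => /=.
  by have := gh j; rewrite !ffunE; lia.
have -> : [set a : {ffun 'I_n -> int} | (sup_norm a <= k)%N] =
    [set` [seq beta g | g <- index_enum _]].
  apply/seteqP; split => [a /= ak|_ /= /mapP[g _ ->]].
    apply/mapP; exists [ffun j => inord `|k%:Z - a j|%N]; first exact: mem_index_enum.
    apply/ffunP => j; rewrite !ffunE.
    have aj : (`|a j| <= k)%N by apply: leq_trans ak; exact: (leq_bigmax j).
    move: (a j) aj => z zk; have zk2 : (`|k%:Z - z| < (2 * k).+1)%N by lia.
    by rewrite inordK//; lia.
  apply/bigmax_leqP => j _; rewrite ffunE.
  by have := ltn_ord (g j); move: (nat_of_ord (g j)) => m mk; lia.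
by rewrite -fsbig_seq ?big_map// map_inj_uniq// index_enum_uniq.
Qed.

Lemma sum_char_square (k : nat) (l : T) :
  \sum_(g : {ffun 'I_n -> 'I_(2 * k).+1})
     torus_char (- [ffun j => k%:Z - (g j)%:Z]) l =
  \prod_(j < n) dirichlet k (l 0 j : C).
Proof.
rewrite /dirichlet bigA_distr_bigA; apply: eq_bigr => g _.
by apply: eq_bigr => j _; rewrite !ffunE opprB.
Qed.

Lemma continuous_dirichlet_prod (k : nat) :
  continuous (fun l : T => \prod_(j < n) dirichlet k (l 0 j : C) : R[i]^o).
Proof.
apply: continuousC_prod => j; apply: continuousC_sum => i.
apply: continuousCexpz => [|l]; first exact: torus_coord_continuous.
exact: torus_neq0.
Qed.

Variables (X : tvsType C) (mu : probability T R).
Hypothesis X_complete : complete_tvs X.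
Variable sigma : T -> X -> X.
Hypothesis sigma_rep : continuous_representation sigma.

Lemma orbit_continuous (x : X) : continuous (fun l => sigma l x).
Proof.
have [_ _ cs] := sigma_rep => l A /(cs (l, x))[[P Q] [/= nP nQ] PQ].
apply: (@filterS _ (nbhs l) _ P) => // l' Pl'.
by apply: (PQ (l', x)); split => //=; exact: nbhs_singleton.
Qed.

Lemma cesaro_mean_kernel (N : nat) (x : X) (phi : {linear X -> R[i]^o}) :
  continuous phi -> phi (cesaro_mean mu sigma N x) =
  cintegral mu (fun l => cesaro_kernel N l * phi (sigma l x)).
Proof.
move=> cphi.
have co : continuous (fun l => phi (sigma l x)).
  move=> l; apply: (@cvg_comp _ _ _ (fun l => sigma l x) phi); last exact: cphi.
  exact: orbit_continuous.
have cc a : continuous (fun l : T => torus_char (- a) l * phi (sigma l x) : R[i]^o).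
  exact: (continuousCM (@continuous_char R n (- a)) co).
have cF a : continuous (fun l : T => torus_char (- a) l *: sigma l x).
  by apply: continuous_scale; [exact: continuous_char|exact: orbit_continuous].
have fc a : phi (fourier_component mu sigma a x) =
    cintegral mu (fun l => torus_char (- a) l * phi (sigma l x)).
  rewrite (pettis_integralP mu X_complete (cF a))//.
  by apply: cintegral_ext => l; rewrite linearZ.
rewrite /cesaro_mean linearZ linear_sum big_mkord /=.
under eq_bigr => k _.
  rewrite /square_partial_sum square_dirichlet linear_sum.
  under eq_bigr do rewrite fc.
  rewrite -(cintegral_sum mu _ (fun g => cc _)).
  under cintegral_ext do rewrite -mulr_suml sum_char_square.
  over.
have ck k : continuous (fun l : T =>
    \prod_(j < n) dirichlet k (l 0 j : C) * phi (sigma l x) : R[i]^o).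
  by apply: continuousCM; [exact: continuous_dirichlet_prod|exact: co].
rewrite -(cintegral_sum mu _ (fun k : 'I_N.+1 => ck k)) -[LHS]/(_ * _).
rewrite -cintegralZ; last by apply: continuousC_sum => k; exact: ck.
by apply: cintegral_ext => l; rewrite /cesaro_kernel -mulr_suml mulrA.
Qed.

End CesaroKernel.

(** * Boundedness and concentration of the kernel *)

(** The two summands on the right have product at least (|K| h)^2, by the lower
    bound on W Q. *)
Lemma weighted_amgm (C : numClosedFieldType) (K W Q c h s : C) :
  0 <= W -> 0 <= Q -> 0 <= c -> 0 <= h -> 0 < s -> 1 <= c * (W * Q) ->
  2 * (`|K| * h) <= s * c * (`|K| ^+ 2 * W) + s^-1 * (h ^+ 2 * Q).
Proof.
move=> W0 Q0 c0 h0 s0 cWQ.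
set A := s * c * _; set B := s^-1 * _.
have A0 : 0 <= A by rewrite !mulr_ge0 ?exprn_ge0 ?(ltW s0).
have B0 : 0 <= B by rewrite !mulr_ge0 ?invr_ge0 ?exprn_ge0 ?(ltW s0).
have AB0 : 0 <= A + B by rewrite addr_ge0.
have Kh0 : 0 <= 2 * (`|K| * h) by rewrite !mulr_ge0.
rewrite -(@ler_pXn2r _ 2) ?nnegrE//.
have AB : (`|K| * h) ^+ 2 <= A * B.
  have -> : A * B = (c * (W * Q)) * (`|K| * h) ^+ 2.
    by rewrite /A /B; field; rewrite gt_eqF.
  by rewrite ler_peMl// exprn_ge0// mulr_ge0.
have sq : 0 <= (A - B) ^+ 2.
  by rewrite -real_normK ?exprn_ge0// realB ?ger0_real.
apply: (@le_trans _ _ (4 * (A * B))).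
  by rewrite exprMn (_ : 2 ^+ 2 = 4 :> C) ?ler_wpM2l// -natrX.
rewrite -subr_ge0 (_ : _ - _ = (A - B) ^+ 2)//; ring.
Qed.

Section KernelBounds.
Variables (R : realType) (n : nat).
Local Notation T := (torus R n).
Local Notation C := (R[i]).
Variable mu : probability T R.
Hypothesis mu_haar : haar mu.

Let b := (2 ^ n.+2)%N.
Let b_gt0 : (0 < b)%N. Proof. by rewrite expn_gt0. Qed.
Let b4 : (4 <= b)%N.
Proof. by rewrite /b !expnS mulnA leq_pmulr// expn_gt0. Qed.
Let nb : (2 ^ n.+1 <= b)%N.
Proof. by rewrite leq_exp2l. Qed.

(** The scale b^L just above N; the factor b lost here only affects constants. *)
Lemma kernel_scale N : exists L, (N.+1 <= b ^ L)%N && (b ^ L <= b * N.+1)%N.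
Proof.
exists (up_log b N.+1); have b1 : (1 < b)%N by apply: leq_trans b4.
rewrite up_logP//=; case: N => [|N]; first by rewrite up_log1 expn0 muln1.
have /andP[h _] := up_log_bounds b1 (isT : (1 < N.+2)%N).
rewrite -(@prednK (up_log b N.+2)); last by rewrite up_log_gt0 b1.
by rewrite expnS leq_mul2l ltnW ?orbT.
Qed.

Lemma laurent_dirichlet k : laurent (dirichlet k : C -> C) 1.
Proof.
apply: laurent_ext (laurent_sum (fun i : 'I_(2 * k).+1 =>
  laurent_monomial 1 (i%:Z - k%:Z))) _ _.
  by move=> z _; apply: eq_bigr => i _; rewrite mul1r.
have kk : (k < (2 * k).+1)%N by lia.
rewrite (bigD1 (Ordinal kk))//= subrr eqxx mulr1 big1 ?addr0// => i ik.
rewrite mul1r; case: eqP => // e; case/eqP: ik; apply: val_inj => /=; lia.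
Qed.

Lemma cintegral_kernel N : cintegral mu (cesaro_kernel N) = 1.
Proof.
have ck k : continuous (fun l : T => \prod_(j < n) dirichlet k (l 0 j : C) : R[i]^o).
  exact: continuous_dirichlet_prod.
rewrite /cesaro_kernel cintegralZ; last exact: continuousC_sum.
rewrite cintegral_sum// (eq_bigr (fun=> 1)) => [|k _].
  by rewrite sumr_const card_ord mulVf// pnatr_eq0.
by rewrite (cintegral_laurent_prod mu_haar (laurent_dirichlet k)) expr1n.
Qed.

Lemma continuous_fejer m (j : 'I_n) :
  continuous (fun l : T => fejer m (l 0 j : C) : R[i]^o).
Proof.
apply: continuousCZ; apply: continuousCX; apply: continuousCnorm.
apply: continuousC_sum => i; apply: continuousCX; exact: torus_coord_continuous.
Qed.

Lemma continuous_dist2 (j : 'I_n) :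
  continuous (fun l : T => `|1 - (l 0 j : C)| ^+ 2 : R[i]^o).
Proof.
apply: continuousCX; apply: continuousCnorm; apply: continuousCD.
  exact: continuousC_cst.
by apply: continuousCN; exact: torus_coord_continuous.
Qed.

Definition weight_prod L (l : T) : C := \prod_(j < n) dual_weight b L (l 0 j : C).
Definition majorant_prod L (l : T) : C := \prod_(j < n) fejer_majorant b L (l 0 j : C).

(** It vanishes at the identity only and dominates each |1 - l_j|^2.  The product
    form, instead of a sum, makes its integral against [majorant_prod] a
    difference of n-th powers of one-variable integrals. *)
Definition distance_prod (l : T) : C := \prod_(j < n) (1 + `|1 - (l 0 j : C)| ^+ 2) - 1.

Lemma continuous_weight_prod L : continuous (weight_prod L : T -> R[i]^o).
Proof.
apply: continuousC_prod => j; apply: continuousCD; first exact: continuousC_cst.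
apply: continuousCM; first exact: continuous_dist2.
by apply: continuousC_sum => i; apply: continuousCZ; exact: continuous_fejer.
Qed.

Lemma continuous_majorant_prod L : continuous (majorant_prod L : T -> R[i]^o).
Proof.
apply: continuousC_prod => j.
by apply: continuousC_sum => i; apply: continuousCZ; exact: continuous_fejer.
Qed.

Lemma continuous_distance_prod : continuous (distance_prod : T -> R[i]^o).
Proof.
apply: continuousCD; last exact: continuousC_cst.
apply: continuousC_prod => j; apply: continuousCD; first exact: continuousC_cst.
exact: continuous_dist2.
Qed.

Lemma continuous_kernel N : continuous (cesaro_kernel N : T -> R[i]^o).
Proof.
apply: continuousCZ; apply: continuousC_sum => k.
exact: continuous_dirichlet_prod.
Qed.

Lemma weight_prod_ge0 L l : 0 <= weight_prod L l.
Proof. by apply: prodr_ge0 => j _; exact: dual_weight_ge0. Qed.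

Lemma majorant_prod_ge0 L l : 0 <= majorant_prod L l.
Proof. by apply: prodr_ge0 => j _; exact: fejer_majorant_ge0. Qed.

Lemma weight_majorant_prod L l :
  1 <= ((64 * b ^ 2) ^ n)%:R * (weight_prod L l * majorant_prod L l).
Proof.
rewrite natrX -[n in _ ^+ n]card_ord -prodr_const -!big_split /=.
rewrite -[leLHS](expr1n _ #|'I_n|) -prodr_const; apply: ler_prod => j _.
by rewrite ler01 majorant_dual_weight// torus_norm.
Qed.

Lemma distance_prod_itv l : 0 <= distance_prod l <= (5 ^ n)%:R.
Proof.
apply/andP; split.
  rewrite subr_ge0 -[leLHS](expr1n _ #|'I_n|) -prodr_const; apply: ler_prod => j _.
  by rewrite ler01 lerDl exprn_ge0.
rewrite lerBlDr (@le_trans _ _ (5 ^ n)%:R)//; last by rewrite lerDl.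
rewrite natrX -[n in _ ^+ n]card_ord -prodr_const; apply: ler_prod => j _.
rewrite addr_ge0//= -lerBrDl (_ : 5 - 1 = 2 ^+ 2 :> C); last by ring.
rewrite lerXn2r ?nnegrE//; apply: le_trans (ler_normB _ _) _.
by rewrite normr1 torus_norm.
Qed.

Lemma distance_prod_ge (l : T) (j : 'I_n) : `|1 - (l 0 j : C)| ^+ 2 <= distance_prod l.
Proof.
rewrite lerBrDl (bigD1 j)//= ler_peMr ?addr_ge0 ?exprn_ge0//.
apply: (big_ind (fun x : C => 1 <= x)) => //; first exact: mulr_ege1.
by move=> i _; rewrite lerDl exprn_ge0.
Qed.

Lemma integral_majorant L : cintegral mu (majorant_prod L) <= (2 ^ n)%:R.
Proof.
rewrite (cintegral_laurent_prod mu_haar (laurent_majorant _ b_gt0 L)).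
have /andP[? ?] := majorant_mass_itv C L.
by rewrite natrX lerXn2r ?nnegrE.
Qed.

(** The integral is (a+e)^n - a^n, where a <= 2 is the integral of q and e that
    of |1-z|^2 q, which is at most 4/2^L; the difference of powers is at most
    n e 6^n as e <= 4. *)
Lemma integral_distance_majorant L :
  cintegral mu (fun l => distance_prod l * majorant_prod L l) <=
  (n * 4 * 6 ^ n)%:R / (2 ^ L)%:R.
Proof.
set a := majorant_mass C L; set e := majorant_moment C b L.
have /andP[a0 a2] : 0 <= a <= 2 := majorant_mass_itv C L.
have /andP[e0 e4] : 0 <= e <= 4 / (2 ^ L)%:R := majorant_moment_itv C b_gt0 L b4.
have p2 : 0 < (2 ^ L)%:R :> C by rewrite ltr0n expn_gt0.
have e4' : e <= 4.
  apply: le_trans e4 _; rewrite ler_pdivrMr// ler_peMr// ler1n expn_gt0//.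
have lau : laurent (fun z : C => (1 + `|1 - z| ^+ 2) * fejer_majorant b L z) (a + e).
  apply: laurent_ext (laurentD (laurent_majorant _ b_gt0 L)
    (laurent_majorant_moment _ b_gt0 L)) _ _ => // z _.
  by rewrite mulrDl mul1r.
have -> : cintegral mu (fun l => distance_prod l * majorant_prod L l) =
    (a + e) ^+ n - a ^+ n.
  rewrite -(cintegral_laurent_prod mu_haar lau).
  rewrite -(cintegral_laurent_prod mu_haar (laurent_majorant _ b_gt0 L)).
  rewrite -mulN1r -cintegralZ; last exact: continuous_majorant_prod.
  rewrite -cintegralD.
  - by apply: cintegral_ext => l; rewrite mulN1r big_split /= /distance_prod mulrBl mul1r.
  - apply: continuousC_prod => j; apply: continuousCM.
      apply: continuousCD; first exact: continuousC_cst.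
      exact: continuous_dist2.
    by apply: continuousC_sum => i; apply: continuousCZ; exact: continuous_fejer.
  - by apply: continuousCZ; exact: continuous_majorant_prod.
rewrite subrXX addrAC subrr add0r.
apply: (@le_trans _ _ (e * (n * 6 ^ n)%:R)).
  rewrite ler_wpM2l//; apply: (@le_trans _ _ (\sum_(i < n) (6 ^ n)%:R)).
    apply: ler_sum => i _; have ni : (n.-1 - i + i <= n)%N by have := ltn_ord i; lia.
    apply: (@le_trans _ _ ((6 ^ (n.-1 - i + i))%:R)); last first.
      by rewrite ler_nat leq_exp2l.
    rewrite expnD natrM !natrX ler_pM ?exprn_ge0 ?addr_ge0//.
      rewrite lerXn2r ?nnegrE ?addr_ge0// (le_trans (lerD a2 e4'))// -natrD//.
    by rewrite lerXn2r ?nnegrE// (le_trans a2)// ler_nat.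
  by rewrite sumr_const card_ord -mulrnA mulnC.
rewrite (_ : (n * 4 * 6 ^ n)%:R / (2 ^ L)%:R = 4 / (2 ^ L)%:R * (n * 6 ^ n)%:R); last first.
  by rewrite mulrAC mulnAC mulnC natrM.
by rewrite ler_wpM2r.
Qed.

Lemma kernel_real N (l : T) : ((cesaro_kernel N l)^*)%R = cesaro_kernel N l.
Proof.
rewrite /cesaro_kernel rmorphM fmorphV rmorph_nat rmorph_sum /=; congr (_ * _).
apply: eq_bigr => k _; rewrite rmorph_prod; apply: eq_bigr => j _.
by rewrite /= dirichlet_real// torus_norm.
Qed.

Section Scale.
Variables (N L : nat).
Hypothesis NL : (N.+1 <= b ^ L)%N && (b ^ L <= b * N.+1)%N.

(** Since the kernel is real, |K_N|^2 is the average over k and k' of the products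
    over j of D_k(l_j) D_k'(l_j); the weight is such a product as well, so the
    integral is the average of the n-th powers of the Gram entries. *)
Lemma integral_kernel_square :
  cintegral mu (fun l => `|cesaro_kernel N l : C| ^+ 2 * weight_prod L l) <=
  (4 * 8 ^ n * b)%:R.
Proof.
have N0 : 0 < N.+1%:R :> C by rewrite ltr0n.
have cD k k' : continuous (fun l : T => \prod_(j < n)
    (dirichlet k (l 0 j : C) * dirichlet k' (l 0 j : C) * dual_weight b L (l 0 j : C))
     : R[i]^o).
  have -> : (fun l : T => \prod_(j < n)
    (dirichlet k (l 0 j : C) * dirichlet k' (l 0 j : C) * dual_weight b L (l 0 j : C))
     : R[i]^o) = (fun l : T => (\prod_(j < n) dirichlet k (l 0 j : C)) *
       (\prod_(j < n) dirichlet k' (l 0 j : C)) * weight_prod L l : R[i]^o).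
    by apply/funext => l; rewrite !big_split.
  apply: continuousCM; last exact: continuous_weight_prod.
  by apply: continuousCM; exact: continuous_dirichlet_prod.
have E : cintegral mu (fun l => `|cesaro_kernel N l : C| ^+ 2 * weight_prod L l) =
    N.+1%:R^-1 ^+ 2 * \sum_(k < N.+1) \sum_(k' < N.+1) gram C b L k k' ^+ n.
  transitivity (cintegral mu (fun l : T => N.+1%:R^-1 ^+ 2 *
     \sum_(k < N.+1) \sum_(k' < N.+1) \prod_(j < n) (dirichlet k (l 0 j : C) *
        dirichlet k' (l 0 j : C) * dual_weight b L (l 0 j : C)))).
    apply: cintegral_ext => l; rewrite normCK kernel_real /cesaro_kernel.
    rewrite mulrACA -expr2 -mulrA; congr (_ * _).
    rewrite mulr_suml mulr_suml; apply: eq_bigr => k _.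
    rewrite mulr_sumr mulr_suml; apply: eq_bigr => k' _.
    by rewrite !big_split.
  rewrite cintegralZ; last first.
    by apply: continuousC_sum => k; apply: continuousC_sum => k'; exact: cD.
  rewrite cintegral_sum; last by move=> k; apply: continuousC_sum => k'; exact: cD.
  congr (_ * _); apply: eq_bigr => k _.
  rewrite cintegral_sum; last by move=> k'; exact: cD.
  apply: eq_bigr => k' _.
  exact: (cintegral_laurent_prod mu_haar (laurent_gram _ b_gt0 L k k')).
have I0 : 0 <= cintegral mu (fun l => `|cesaro_kernel N l : C| ^+ 2 * weight_prod L l).
  rewrite -(cintegral_cst mu 0); apply: le_cintegral.
  - exact: continuousC_cst.
  - apply: continuousCM; last exact: continuous_weight_prod.
    by apply: continuousCX; apply: continuousCnorm; exact: continuous_kernel.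
  - by move=> l; rewrite mulr_ge0 ?exprn_ge0 ?weight_prod_ge0.
rewrite -(ger0_norm I0) E normrM ger0_norm ?exprn_ge0 ?invr_ge0//.
have /andP[NL1 NL2] := NL.
rewrite exprVn ler_pdivrMl ?exprn_gt0//.
apply: (@le_trans _ _ (\sum_(k < N.+1) \sum_(k' < N.+1) `|gram C b L k k'| ^+ n)).
  apply: le_trans (ler_norm_sum _ _ _) _; apply: ler_sum => k _.
  apply: le_trans (ler_norm_sum _ _ _) _; apply: ler_sum => k' _.
  by rewrite normrX.
apply: le_trans (gram_sum_le _ b_gt0 nb NL1) _.
rewrite -natrX -natrM ler_nat.
apply: (@leq_trans (4 * 8 ^ n * N.+1 * (b * N.+1))); first by rewrite leq_mul2l NL2 orbT.
by rewrite mulnACA [X in (_ <= X)%N]mulnC.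
Qed.

Let c1 := ((64 * b ^ 2) ^ n)%N.

Lemma integral_kernel_le (h : T -> C) (s : C) : continuous (h : T -> R[i]^o) ->
  (forall l, 0 <= h l) -> 0 < s ->
  2 * cintegral mu (fun l => `|cesaro_kernel N l : C| * h l) <=
  s * (c1 * (4 * 8 ^ n * b))%:R +
  s^-1 * cintegral mu (fun l => h l ^+ 2 * majorant_prod L l).
Proof.
move=> ch h0 s0.
have cK : continuous (fun l : T => `|cesaro_kernel N l : C| : R[i]^o).
  by apply: continuousCnorm; exact: continuous_kernel.
have cKh : continuous (fun l : T => `|cesaro_kernel N l : C| * h l : R[i]^o).
  by apply: continuousCM; [exact: cK|exact: ch].
have cKW : continuous (fun l : T =>
    `|cesaro_kernel N l : C| ^+ 2 * weight_prod L l : R[i]^o).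
  apply: continuousCM; last exact: continuous_weight_prod.
  by apply: continuousCX; exact: cK.
have chQ : continuous (fun l : T => h l ^+ 2 * majorant_prod L l : R[i]^o).
  apply: continuousCM; last exact: continuous_majorant_prod.
  by apply: continuousCX; exact: ch.
rewrite -cintegralZ; last exact: cKh.
apply: (@le_trans _ _ (s * c1%:R *
    cintegral mu (fun l => `|cesaro_kernel N l : C| ^+ 2 * weight_prod L l) +
  s^-1 * cintegral mu (fun l => h l ^+ 2 * majorant_prod L l))); last first.
  rewrite lerD2r natrM mulrA ler_wpM2l ?integral_kernel_square//.
  by rewrite mulr_ge0// ltW.
rewrite -(cintegralZ _ _ cKW) -(cintegralZ _ _ chQ) -cintegralD.
- apply: le_cintegral.
  + by apply: continuousCZ; exact: cKh.
  + by apply: continuousCD; apply: continuousCZ; [exact: cKW|exact: chQ].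
  + move=> l; apply: weighted_amgm => //.
    * exact: weight_prod_ge0.
    * exact: majorant_prod_ge0.
    * exact: weight_majorant_prod.
- by apply: continuousCZ; exact: cKW.
- by apply: continuousCZ; exact: chQ.
Qed.

End Scale.
End KernelBounds.

Section KernelAsymptotics.
Variables (R : realType) (n : nat).
Local Notation T := (torus R n).
Local Notation C := (R[i]).
Variable mu : probability T R.
Hypothesis mu_haar : haar mu.

Let b := (2 ^ n.+2)%N.
Let c2 := ((64 * b ^ 2) ^ n * (4 * 8 ^ n * b))%N.

(** The weighted inequality with h = 1 and s = 1. *)
Lemma kernel_L1_bounded : exists D : nat, forall N,
  cintegral mu (fun l => `|cesaro_kernel N l : C|) <= D%:R.
Proof.
exists (c2 + 2 ^ n)%N => N.
have [L NL] := kernel_scale n N.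
have cK : continuous (fun l : T => `|cesaro_kernel N l : C| : R[i]^o).
  by apply: continuousCnorm; exact: continuous_kernel.
have I0 : 0 <= cintegral mu (fun l => `|cesaro_kernel N l : C|).
  rewrite -(cintegral_cst mu 0); apply: le_cintegral.
  - exact: continuousC_cst.
  - exact: cK.
  - by [].
have := integral_kernel_le mu_haar NL (@continuousC_cst R T 1)
  (fun=> ler01) (ltr01 : 0 < 1 :> C).
have -> : cintegral mu (fun l => `|cesaro_kernel N l : C| * 1) =
    cintegral mu (fun l => `|cesaro_kernel N l : C|).
  by apply: cintegral_ext => l; rewrite mulr1.
have -> : cintegral mu (fun l => 1 ^+ 2 * majorant_prod L l) =
    cintegral mu (majorant_prod L).
  by apply: cintegral_ext => l; rewrite expr1n mul1r.
rewrite invr1 !mul1r => h; rewrite natrD.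
apply: le_trans (_ : _ <= 2 * cintegral mu (fun l => `|cesaro_kernel N l : C|)) _.
  by rewrite ler_peMl// ler1n.
by rewrite (le_trans h)// lerD2l (integral_majorant mu_haar).
Qed.

(** The parameter s is taken to be 2^-j, and L >= 2j makes the integral of
    h^2 Q smaller than 2^-(2j) up to a constant. *)
Lemma kernel_concentrates : exists D : nat, forall j N,
  ((2 ^ n.+2) ^ (2 * j) <= N)%N ->
  cintegral mu (fun l => `|cesaro_kernel N l : C| * distance_prod l) <=
  D%:R / (2 ^ j)%:R.
Proof.
exists (c2 + 5 ^ n * (n * 4 * 6 ^ n))%N => j N jN.
have [L NL] := kernel_scale n N.
have jL : (2 * j <= L)%N.
  have /andP[NL1 _] := NL; rewrite -(@leq_exp2l b); last first.
    by rewrite -{1}(expn0 2) ltn_exp2l.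
  exact: leq_trans jN (ltnW NL1).
have p2 i : 0 < (2 ^ i)%:R :> C by rewrite ltr0n expn_gt0.
have H0 (l : T) : 0 <= distance_prod l by case/andP: (distance_prod_itv l).
have cH := @continuous_distance_prod R n.
have cQ := @continuous_majorant_prod R n L.
have cHQ : continuous (fun l : T => distance_prod l * majorant_prod L l : R[i]^o).
  by apply: continuousCM; [exact: cH|exact: cQ].
have cKH : continuous (fun l : T => `|cesaro_kernel N l : C| * distance_prod l : R[i]^o).
  by apply: continuousCM; [apply: continuousCnorm; exact: continuous_kernel|exact: cH].
have I0 : 0 <= cintegral mu (fun l => `|cesaro_kernel N l : C| * distance_prod l).
  rewrite -(cintegral_cst mu 0); apply: le_cintegral.
  - exact: continuousC_cst.
  - exact: cKH.
  - by move=> l; rewrite mulr_ge0.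
have s0 : 0 < (2 ^ j)%:R^-1 :> C by rewrite invr_gt0.
have := integral_kernel_le mu_haar NL cH H0 s0.
rewrite invrK => h.
have hH : cintegral mu (fun l => distance_prod l ^+ 2 * majorant_prod L l) <=
    (5 ^ n)%:R * ((n * 4 * 6 ^ n)%:R / (2 ^ L)%:R).
  apply: (@le_trans _ _ ((5 ^ n)%:R *
      cintegral mu (fun l => distance_prod l * majorant_prod L l))); last first.
    by rewrite ler_wpM2l// (integral_distance_majorant mu_haar).
  rewrite -(cintegralZ _ _ cHQ); apply: le_cintegral.
  - by apply: continuousCM; [apply: continuousCX; exact: cH|exact: cQ].
  - by apply: continuousCZ; exact: cHQ.
  - move=> l; rewrite mulrA ler_wpM2r ?majorant_prod_ge0// expr2 ler_wpM2r//.
    by case/andP: (distance_prod_itv l).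
apply: le_trans (_ : _ <= 2 * cintegral mu (fun l => `|cesaro_kernel N l : C| * distance_prod l)) _.
  by rewrite ler_peMl// ler1n.
apply: le_trans h _; rewrite natrD mulrDl mulrC lerD2l.
apply: (@le_trans _ _ ((2 ^ j)%:R * ((5 ^ n)%:R * ((n * 4 * 6 ^ n)%:R / (2 ^ L)%:R)))).
  by rewrite ler_wpM2l.
rewrite ler_pdivlMr// (natrM _ (5 ^ n)).
set D1 := (5 ^ n)%:R; set D2 := (n * 4 * 6 ^ n)%:R; set J := (2 ^ j)%:R.
rewrite (_ : J * _ * J = D1 * D2 * (J * J / (2 ^ L)%:R)); last by ring.
rewrite ler_piMr ?mulr_ge0// ler_pdivrMr// mul1r -natrM -expnD addnn -mul2n.
by rewrite ler_nat leq_exp2l.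
Qed.

End KernelAsymptotics.

(** * Convergence *)

Section OrbitEstimate.
Variables (R : realType) (n : nat) (X : tvsType R[i]).
Local Notation T := (torus R n).
Local Notation C := (R[i]).
Variable sigma : T -> X -> X.
Hypothesis sigma_rep : continuous_representation sigma.

(** The operator attached to 1 is idempotent and injective. *)
Lemma representation1 (x : X) : sigma 1%g x = x.
Proof.
have [sh sM _] := sigma_rep; have [_ _ [g [gK _ _]]] := sh 1%g.
have := sM 1%g 1%g; rewrite mulg1 => /(congr1 (fun f => g (f x))) /=.
by rewrite !gK.
Qed.

Lemma seminorm_continuous (p : X -> R) : real_seminorm p -> continuous p.
Proof.
move=> [pD pZ pn] x; apply/cvgrPdist_lt => e e0.
have := nbhsT x (pn e e0); apply: filterS => _ [y /= ye <-].
have pN z : p (- z) = p z.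
  by have := pZ (-1) z; rewrite rmorphN rmorph1 scaleN1r normrN1 mul1r.
have h1 := pD x y; have h2 := pD (x + y) (- y).
rewrite addrK pN in h2; rewrite ltr_norml; apply/andP; split; lra.
Qed.

(** Near the identity the left-hand side is at most e by continuity.  Elsewhere
    some |1 - l_j| is at least a fixed d, and A is a bound of the left-hand side
    divided by d^2. *)
Lemma orbit_seminorm_bound (p : X -> R) (x : X) (e : R) :
  real_seminorm p -> 0 < e ->
  exists2 A : C, 0 <= A & forall l : T,
    (p (sigma l x - x))%:C <= e%:C + A * distance_prod l.
Proof.
move=> psem e0.
pose g (l : T) : R := p (sigma l x - x).
have cg : continuous g.
  move=> l; apply: (@cvg_comp _ _ _ (fun l : T => sigma l x - x) p); last first.
    exact: seminorm_continuous.
  move=> A /(@add_continuous X (sigma l x, - x))[[P Q] [/= nP nQ] PQ].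
  have : nbhs l [set l' | P (sigma l' x)] by exact: (@orbit_continuous _ _ _ _ sigma_rep x l P nP).
  apply: filterS => l' Pl'.
  by apply: (PQ (sigma l' x, - x)); split => //=; exact: nbhs_singleton.
have [M MP] := torus_continuous_bounded cg.
have M0 : 0 <= M by apply: le_trans (MP 1%g).
have g1 : g 1%g = 0.
  have [_ pZ _] := psem; rewrite /g representation1 subrr.
  by rewrite -(scale0r (0 : X)) (pZ 0) normr0 mul0r.
have near1 : nbhs (1%g : T) [set l | g l < e].
  have /cvgrPdist_lt/(_ _ e0) := cg 1%g; rewrite g1.
  apply: filterS => l /=; rewrite sub0r normrN; exact: le_lt_trans (ler_norm _).
move: near1; rewrite nbhsE => -[_ [[V Vop <-] V1] VU].
have /nbhs_ballP[d /= d0 dV] : nbhs (torus_val (1%g : T)) V by apply: open_nbhs_nbhs.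
have d2 : 0 < d ^+ 2 by rewrite exprn_gt0.
exists (M%:C / d ^+ 2); first by rewrite divr_ge0 ?ler0c// ltW.
move=> l; have [H0 _] := andP (distance_prod_itv l).
have e0C : 0 <= e%:C :> C by rewrite ler0c ltW.
have [/forallP near|] := boolP [forall j, `|1 - (l 0 j : C)| < d].
  apply: (@le_trans _ _ e%:C); last first.
    by rewrite lerDl mulr_ge0// divr_ge0 ?ler0c// ltW.
  rewrite lecR; apply/ltW; apply: (VU l); apply: dV; split => // i j.
  by rewrite (ord1 i) mxE -ball_normE; exact: near.
rewrite negb_forall => /existsP[j].
rewrite -real_leNgt ?normr_real ?gtr0_real// => dj.
apply: (@le_trans _ _ M%:C).
  by rewrite lecR; apply: le_trans (MP l); exact: ler_norm.
rewrite -[leLHS]add0r lerD// mulrAC ler_pdivlMr// ler_wpM2l ?ler0c//.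
apply: le_trans (distance_prod_ge l j).
by rewrite lerXn2r ?nnegrE// ltW.
Qed.

End OrbitEstimate.

Theorem theorem2p1 (R : realType) (n : nat) (X : tvsType R[i])
    (X_hausdorff : hausdorff_space X) (X_complete : complete_tvs X)
    (mu : probability (torus R n) R) (mu_haar : haar mu)
    (sigma : torus R n -> X -> X) (sigma_rep : continuous_representation sigma)
    (x : X) :
  cesaro_mean mu sigma N x @[N --> \oo] --> x.
Proof.
have [D0 kernel0] := kernel_L1_bounded mu_haar.
have [D1 kernel1] := kernel_concentrates mu_haar.
move=> U Ux.
have Ux0 : nbhs 0 [set y | U (x + y)].
  have := nbhsB (- x) Ux; rewrite addNr; apply: filterS => _ [u Uu <-].
  by rewrite /= addrA subrr add0r.
have [p psem pU] := seminorm_nbhs Ux0.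
(* This keeps the contribution of the L^1 norm of the kernel below 1/2. *)
pose e : R := (2 * D0.+1)%:R^-1.
have e0 : 0 < e by rewrite invr_gt0 ltr0n.
have [A A0 AP] := orbit_seminorm_bound sigma_rep x psem e0.
have AE : A = (complex.Re A)%:C by rewrite RRe_real// ger0_real.
(* This bounds by 1/2 the contribution of the points away from the identity. *)
have [j jA] : exists j, 2 * (complex.Re A * D1%:R) < (2 ^ j)%:R.
  exists (Num.trunc (2 * (complex.Re A * D1%:R))).+1.
  apply: lt_trans (truncnS_gt _) _; rewrite ltr_nat; exact: ltn_expl.
suff claim N : ((2 ^ n.+2) ^ (2 * j) <= N)%N -> p (cesaro_mean mu sigma N x - x) < 1.
  exists ((2 ^ n.+2) ^ (2 * j))%N => // N /= jN.
  by have := pU _ (claim N jN); rewrite /= addrC subrK.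
move=> jN; have [phi [cphi phip <-]] := norming_functional (cesaro_mean mu sigma N x - x) psem.
have co : continuous (fun l => phi (sigma l x) : R[i]^o).
  by move=> l; apply: (@cvg_comp _ _ _ (fun l => sigma l x) phi);
    [exact: orbit_continuous|exact: cphi].
have cK := @continuous_kernel R n N.
have cKphi : continuous (fun l : torus R n =>
    cesaro_kernel N l * phi (sigma l x - x) : R[i]^o).
  apply: continuousCM; first exact: cK.
  have -> : (fun l => phi (sigma l x - x)) = fun l => phi (sigma l x) + - phi x.
    by apply/funext => l; rewrite linearB.
  by apply: continuousCD; [exact: co|exact: continuousC_cst].
have -> : phi (cesaro_mean mu sigma N x - x) =
    cintegral mu (fun l => cesaro_kernel N l * phi (sigma l x - x)).
  rewrite linearB (cesaro_mean_kernel mu X_complete sigma_rep N x cphi)//.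
  rewrite -[phi x in LHS]mulr1 -(cintegral_kernel mu_haar N) -mulNr -cintegralZ//.
  rewrite -cintegralD.
  - by apply: cintegral_ext => l; rewrite linearB mulrBr mulNr [phi x * _]mulrC.
  - by apply: continuousCM; [exact: cK|exact: co].
  - by apply: continuousCZ; exact: cK.
have cabs : continuous (fun l : torus R n => `|cesaro_kernel N l : R[i]| : R[i]^o).
  by apply: continuousCnorm; exact: cK.
have cH := @continuous_distance_prod R n.
have ptw l : `|complex.Re (cesaro_kernel N l * phi (sigma l x - x))|%:C <=
    e%:C * `|cesaro_kernel N l| + A * (`|cesaro_kernel N l| * distance_prod l).
  have KE : cesaro_kernel N l = (complex.Re (cesaro_kernel N l))%:C.
    by rewrite RRe_real//; apply/CrealP; exact: kernel_real.
  have -> : `|complex.Re (cesaro_kernel N l * phi (sigma l x - x))|%:C =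
      `|cesaro_kernel N l| * `|complex.Re (phi (sigma l x - x))|%:C.
    rewrite KE; move: (complex.Re (cesaro_kernel N l)) => k.
    have -> : `|k%:C : R[i]| = `|k|%:C.
      by rewrite normc_def /= expr0n addr0 sqrtr_sqr.
    by rewrite -rmorphM -normrM; case: (phi _) => u v; simpc.
  have -> : e%:C * `|cesaro_kernel N l| +
      A * (`|cesaro_kernel N l| * distance_prod l) =
      `|cesaro_kernel N l| * (e%:C + A * distance_prod l) by ring.
  rewrite ler_wpM2l//; apply: le_trans (AP l); rewrite lecR; exact: phip.
have ckH : continuous (fun l : torus R n =>
    `|cesaro_kernel N l : R[i]| * distance_prod l : R[i]^o).
  by apply: continuousCM; [exact: cabs|exact: cH].
have c1 := continuousCZ (a := e%:C) cabs; have c2 := continuousCZ (a := A) ckH.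
have := norm_Re_cintegral_le mu cKphi (continuousCD c1 c2) ptw.
rewrite (cintegralD mu c1 c2) (cintegralZ mu _ cabs) (cintegralZ mu _ ckH) => h.
have I1 := kernel0 N.
have I2 := kernel1 j N jN.
rewrite -ltcR; apply: le_lt_trans (_ : _ <= _) _.
  by apply: le_trans h; rewrite lecR ler_norm.
apply: (@le_lt_trans _ _ (e%:C * D0%:R + A * (D1%:R / (2 ^ j)%:R))).
  apply: lerD; first by rewrite ler_wpM2l// ler0c ltW.
  by rewrite ler_wpM2l.
have p2 : 0 < (2 ^ j)%:R :> R by rewrite ltr0n expn_gt0.
have castE (a c : R) (u v w : nat) :
    a%:C * u%:R + c%:C * (v%:R / w%:R) = (a * u%:R + c * (v%:R / w%:R))%:C :> R[i].
  by rewrite rmorphD !rmorphM/= fmorphV !rmorph_nat.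
rewrite AE castE.
have half (D : nat) : (2 * D.+1)%:R^-1 * D%:R < 1 / 2 :> R.
  rewrite ltr_pdivrMl ?ltr0n// natrM mul1r mulrAC divff ?pnatr_eq0// mul1r.
  by rewrite ltr_nat.
rewrite ltcR [X in _ < X](splitr 1) ltrD ?half//.
by rewrite mulrA ltr_pdivrMr// mul1r -ltr_pdivrMl// invrK.
Qed.
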